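(* Let $\lambda$ be a partition of $n$ and $(\alpha|\beta)$ a bicomposition of $n$. Let $\phi\in\mathrm{Hom}_{\mathbb{Z}\mathfrak{S}_n}\big(S^\lambda_{\mathbb{Z}},M_{\mathbb{Z}}(\alpha|\beta)\big)$. Then $\phi$ lies in the $\mathbb{Q}$-span of $\Theta_{\mathrm{sstd}}=\{\hat\vartheta_{\mathfrak{d}}:\mathfrak{d}\in\Gamma_{\mathrm{sstd}}\}$; that is, there are $c_{\mathfrak{d}}\in\mathbb{Q}$ ($\mathfrak{d}\in\Gamma_{\mathrm{sstd}}$) with $\phi=\sum_{\mathfrak{d}\in\Gamma_{\mathrm{sstd}}}c_{\mathfrak{d}}\hat\vartheta_{\mathfrak{d}}$ (an equality of maps into $\mathbb{Q}\otimes_{\mathbb{Z}}M_{\mathbb{Z}}(\alpha|\beta)$).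
   Context: $\mathfrak{S}_n$ is the symmetric group on $\{1,\dots,n\}$ with product given by composition of functions; $n\ge1$. A composition is a finite sequence of positive integers (the empty one, $\varnothing$, is the composition of $0$); $|\lambda|$ is the sum of the parts, $\ell(\lambda)$ the number of parts; a partition is a weakly decreasing composition. A bicomposition $(\alpha|\beta)$ of $n$ is a pair of compositions with $|\alpha|+|\beta|=n$. For a composition $\mu$ of $m$, $\mathfrak{S}_\mu\le\mathfrak{S}_m$ is the Young subgroup of permutations preserving each of the consecutive blocks of sizes $\mu_1,\mu_2,\dots$ of $\{1,\dots,m\}$. For $\xi\in\mathfrak{S}_m$ and $k\ge0$, $\xi^{+k}$ is the permutation of $\{k+1,\dots,k+m\}$ with $\xi^{+k}(x+k)=\xi(x)+k$ (extended by the identity). $\mathfrak{S}_{\alpha|\beta}=\mathfrak{S}_\alpha\mathfrak{S}_\beta^{+|\alpha|}\cong\mathfrak{S}_\alpha\times\mathfrak{S}_\beta$. Tableaux: $[\lambda]=\{(i,j):1\le i\le\ell(\lambda),1\le j\le\lambda_i\}$. A $\lambda$-tableau is a bijection $\mathfrak{t}\colon[\lambda]\to\{1,\dots,n\}$. $R_{\mathfrak{t}}$ (resp. $C_{\mathfrak{t}}$) $\le\mathfrak{S}_n$ is the subgroup of permutations preserving the set of entries of each row (resp. column) of $\mathfrak{t}$. A $\lambda$-tableau of type $(\alpha|\beta)$ is a function $\mathrm{T}\colon[\lambda]\to\{\mathbf{c}_1,\dots,\mathbf{c}_{\ell(\alpha)},\mathbf{d}_1,\dots,\mathbf{d}_{\ell(\beta)}\}$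 taking the value $\mathbf{c}_i$ exactly $\alpha_i$ times and $\mathbf{d}_j$ exactly $\beta_j$ times. Colours are ordered $\mathbf{c}_1<\mathbf{c}_2<\cdots<\mathbf{d}_1<\mathbf{d}_2<\cdots$. $\mathrm{T}$ is semistandard if rows and columns are weakly increasing, equal entries in distinct nodes of the same row occur only for colours $\mathbf{c}_k$, and equal entries in distinct nodes of the same column occur only for colours $\mathbf{d}_k$; $\mathcal{T}_{\mathrm{sstd}}(\lambda,(\alpha|\beta))$ is the set of these. Fix a $\lambda$-tableau $\mathfrak{t}_0$. $\mathrm{T}_0$ is the tableau of type $(\alpha|\beta)$ colouring the nodes labelled $1,\dots,\alpha_1$ by $\mathfrak{t}_0$ with $\mathbf{c}_1$, the next $\alpha_2$ labels with $\mathbf{c}_2$, and so on through $\mathbf{c}_{\ell(\alpha)}$, then $\mathbf{d}_1$ for the next $\beta_1$ labels, etc. $\mathfrak{S}_n$ acts by $\sigma\cdot\mathrm{T}=\mathrm{T}\circ\mathfrak{t}_0^{-1}\circ\sigma^{-1}\circ\mathfrak{t}_0$, and $\mathrm{T}_d=d\cdot\mathrm{T}_0$. Fix a left transversal $\Gamma$ of $\mathfrak{S}_{\alpha|\beta}$ in $\mathfrak{S}_n$ (representatives of left cosets) and put $\Gamma_{\mathrm{sstd}}=\{d\in\Gamma:\mathrm{T}_d\in\mathcal{T}_{\mathrm{sstd}}(\lambda,(\alpha|\beta))\}$. Coefficients: $\mathcal{R}=\{d\in\mathfrak{S}_n:d^{-1}R_{\mathfrak{t}_0}d\cap\mathfrak{S}_{\alpha|\beta}\subseteq\mathfrak{S}_\alpha\}$;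 one has $\Gamma_{\mathrm{sstd}}\subseteq\mathcal{R}$. For $\mathfrak{d}\in\mathcal{R}$ there is a well-defined map $\varepsilon_{\mathfrak{d}}\colon R_{\mathfrak{t}_0}\mathfrak{d}\mathfrak{S}_{\alpha|\beta}\to\{\pm1\}$, $\varepsilon_{\mathfrak{d}}(\tau\mathfrak{d}\xi_\alpha\xi_\beta^{+|\alpha|})=\mathrm{sgn}(\xi_\beta)$ ($\tau\in R_{\mathfrak{t}_0}$, $(\xi_\alpha,\xi_\beta)\in\mathfrak{S}_\alpha\times\mathfrak{S}_\beta$). For $d\in\mathfrak{S}_n$, $\mathfrak{a}_{d,\mathfrak{d}}=\sum\mathrm{sgn}(\sigma)\varepsilon_{\mathfrak{d}}(\sigma d)\in\mathbb{Z}$, the sum over $\sigma\in C_{\mathfrak{t}_0}$ with $\sigma d\in R_{\mathfrak{t}_0}\mathfrak{d}\mathfrak{S}_{\alpha|\beta}$. Modules: $M^\lambda_{\mathbb{Z}}$ is the permutation $\mathbb{Z}\mathfrak{S}_n$-module on $\mathfrak{S}_n/\mathfrak{S}_\lambda$; with $\mathfrak{t}^\lambda(i,j)=\lambda_1+\dots+\lambda_{i-1}+j$ and $d_{\mathfrak{t}}=\mathfrak{t}\circ(\mathfrak{t}^\lambda)^{-1}$, $e_{\mathfrak{t}}=\sum_{\sigma\in C_{\mathfrak{t}}}\mathrm{sgn}(\sigma)\sigma d_{\mathfrak{t}}\mathfrak{S}_\lambda$; $S^\lambda_{\mathbb{Z}}$ is the $\mathbb{Z}$-span of all $e_{\mathfrak{t}}$.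 $M_{\mathbb{Z}}(\alpha|\beta)=\mathrm{Ind}_{\mathfrak{S}_\alpha\times\mathfrak{S}_\beta}^{\mathfrak{S}_n}(\mathbb{Z}\boxtimes\mathrm{sgn})$ (identifying $\mathfrak{S}_\alpha\times\mathfrak{S}_\beta$ with $\mathfrak{S}_{\alpha|\beta}$) has basis $\{d\otimes1\otimes\epsilon:d\in\Gamma\}$, with $\sigma\cdot(x\otimes1\otimes\epsilon)=\sigma x\otimes1\otimes\epsilon$ and $x\xi_\alpha\xi_\beta^{+|\alpha|}\otimes1\otimes\epsilon=\mathrm{sgn}(\xi_\beta)(x\otimes1\otimes\epsilon)$. Homomorphisms: for $\mathfrak{d}\in\mathcal{R}$, $\hat\vartheta_{\mathfrak{d}}\colon S^\lambda_{\mathbb{Z}}\to M_{\mathbb{Z}}(\alpha|\beta)$ is the $\mathbb{Z}\mathfrak{S}_n$-homomorphism with $\hat\vartheta_{\mathfrak{d}}(e_{\mathfrak{t}})=\sum_{d\in\Gamma}\mathfrak{a}_{\rho_{\mathfrak{t}}^{-1}d,\mathfrak{d}}(d\otimes1\otimes\epsilon)$, where $\rho_{\mathfrak{t}}=\mathfrak{t}\circ\mathfrak{t}_0^{-1}$. *)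

(* Defs.v *)
From HB Require Import structures.
From mathcomp Require Import all_boot all_order all_algebra all_fingroup.
From mathcomp Require Import boolp.

Set Implicit Arguments.
Unset Strict Implicit.
Unset Printing Implicit Defensive.
Import GRing.Theory.
Local Open Scope ring_scope.

(* The set {1, ..., n} is modelled by 'I_n = {0, ..., n - 1}, and rows, columns
   and colours are numbered from 0.  MathComp's product of permutations is
   composition in the reverse order, (s * t) x = t (s x); [s ∘ t] is the
   product of the symmetric group as composition of functions. *)
Notation "s ∘ t" := (t * s)%g (at level 40, left associativity, only parsing).

Definition psgn (m : nat) (s : 'S_m) : int := (-1) ^+ (s : bool).

Definition is_composition (mu : seq nat) := all (fun k => 0 < k)%N mu.
Definition is_partition (mu : seq nat) := is_composition mu && sorted geq mu.

Record intpart (n : nat) := IntPart {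
  parts :> seq nat;
  intpart_partition : is_partition parts;
  intpart_sum : sumn parts = n }.

Record bicomp (n : nat) := BiComp {
  bca : seq nat;
  bcb : seq nat;
  bca_composition : is_composition bca;
  bcb_composition : is_composition bcb;
  bicomp_sum : (sumn bca + sumn bcb = n)%N }.

(* [reshape_index mu x] is the index of the block of [mu] containing [x]. *)
Definition young (m : nat) (mu : seq nat) : {set 'S_m} :=
  [set s : 'S_m | [forall x, reshape_index mu (s x) == reshape_index mu x]].

(* The permutation xi^{+k}, viewed in 'S_n. *)
Section Shift.
Context (n k m : nat) (hkm : (k + m <= n)%N).

Definition shift_fun (xi : 'S_m) (x : 'I_n) : 'I_n :=
  if (k <= x)%N then
    if (insub (x - k)%N : option 'I_m) is Some y then insubd x (k + xi y)%N else x
  else x.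

Lemma shift_funE xi (y : 'I_m) (x : 'I_n) :
  x = (k + y)%N :> nat -> shift_fun xi x = (k + xi y)%N :> nat.
Proof.
move=> Ex; rewrite /shift_fun Ex leq_addr addKn valK val_insubd.
by rewrite (leq_trans _ hkm) // ltn_add2l.
Qed.

Lemma shift_fun_id xi (x : 'I_n) :
  ~~ (k <= x < k + m)%N -> shift_fun xi x = x.
Proof.
rewrite /shift_fun; case: (leqP k x) => //= lekx; rewrite -leqNgt => lex.
by rewrite insubF // ltnNge leq_subRL // lex.
Qed.

Lemma shift_cases (x : 'I_n) :
  (exists y : 'I_m, x = (k + y)%N :> nat) \/ ~~ (k <= x < k + m)%N.
Proof.
case: (boolP (k <= x < k + m)%N) => [/andP[lekx ltx]|]; [left | by right].
have lt: (x - k < m)%N by rewrite ltn_subLR.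
by exists (Ordinal lt); rewrite /= subnKC.
Qed.

Lemma shift_fun_inj xi : injective (shift_fun xi).
Proof.
move=> x1 x2.
have [[y1 E1]|o1] := shift_cases x1; have [[y2 E2]|o2] := shift_cases x2.
- move/(congr1 val); rewrite /= (shift_funE _ E1) (shift_funE _ E2).
  move/addnI/val_inj/perm_inj=> Ey; apply: val_inj.
  by rewrite /= E1 E2 Ey.
- move/(congr1 val); rewrite /= (shift_funE _ E1) shift_fun_id //= => E.
  by case/negP: o2; rewrite -E leq_addr ltn_add2l ltn_ord.
- move/(congr1 val); rewrite /= (shift_funE _ E2) shift_fun_id //= => E.
  by case/negP: o1; rewrite E leq_addr ltn_add2l ltn_ord.
- by rewrite !shift_fun_id.
Qed.

Definition shift (xi : 'S_m) : 'S_n := perm (@shift_fun_inj xi).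

Lemma shiftE xi (y : 'I_m) (x : 'I_n) :
  x = (k + y)%N :> nat -> shift xi x = (k + xi y)%N :> nat.
Proof. by move=> Ex; rewrite permE (shift_funE _ Ex). Qed.

Lemma shift_id xi (x : 'I_n) : ~~ (k <= x < k + m)%N -> shift xi x = x.
Proof. by move=> ox; rewrite permE shift_fun_id. Qed.

Lemma shiftM : {morph shift : s t / (s * t)%g}.
Proof.
move=> s t; apply/permP=> x; rewrite permM.
have [[y Ex]|ox] := shift_cases x; last by rewrite !shift_id.
apply: val_inj; rewrite /= (shiftE _ Ex) permM.
by rewrite (shiftE _ (shiftE s Ex)).
Qed.

End Shift.

Section Bicomposition.
Context (n : nat) (ab : bicomp n).
Let a := sumn (bca ab).
Let b := sumn (bcb ab).

Fact bca_leq : (0 + a <= n)%N.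
Proof. by rewrite -(bicomp_sum ab) leq_addr. Qed.
Fact bcb_leq : (a + b <= n)%N.
Proof. by rewrite -(bicomp_sum ab). Qed.

Definition shiftA (xi : 'S_a) : 'S_n := shift bca_leq xi.
Definition shiftB (xi : 'S_b) : 'S_n := shift bcb_leq xi.

Definition youngA : {set 'S_n} := [set shiftA xi | xi in young a (bca ab)].
Definition youngAB : {set 'S_n} :=
  [set shiftA xa ∘ shiftB xb | xa in young a (bca ab), xb in young b (bcb ab)].

End Bicomposition.

Definition left_coset (n : nat) (s : 'S_n) (H : {set 'S_n}) : {set 'S_n} :=
  [set s ∘ h | h in H].
Definition left_cosets (n : nat) (H : {set 'S_n}) : {set {set 'S_n}} :=
  [set left_coset s H | s : 'S_n].

Definition left_transversal (n : nat) (H Gamma : {set 'S_n}) :=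
  is_transversal Gamma (left_cosets H) [set: 'S_n].

Definition node (lam : seq nat) := {i : 'I_(size lam) & 'I_(nth 0%N lam i)}.
Definition row_of (lam : seq nat) (x : node lam) : nat := tag x.
Definition col_of (lam : seq nat) (x : node lam) : nat := tagged x.

Definition is_bij (T U : finType) (f : {ffun T -> U}) :=
  injectiveb f && [forall u, u \in codom f].

Definition tableau (n : nat) (lam : seq nat) :=
  {t : {ffun node lam -> 'I_n} | is_bij t}.

Section Tableau.
Context (n : nat) (lam : seq nat).
Implicit Types (s t : tableau n lam) (x : node lam).

Fact tableau_inj t : injective (val t).
Proof. by apply/injectiveP; case/andP: (valP t). Qed.
Fact tableau_codom t (u : 'I_n) : u \in codom (val t).
Proof. by case/andP: (valP t) => _ /forallP. Qed.

Definition tab_inv t (u : 'I_n) : node lam := iinv (tableau_codom t u).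

Lemma tab_invK t : cancel (tab_inv t) (val t).
Proof. by move=> u; apply: f_iinv. Qed.
Lemma tabK t : cancel (val t) (tab_inv t).
Proof. by move=> x; apply: (@tableau_inj t); rewrite tab_invK. Qed.

Definition row_set t (x : node lam) : {set 'I_n} :=
  [set val t y | y in [pred y | row_of y == row_of x]].
Definition col_set t (x : node lam) : {set 'I_n} :=
  [set val t y | y in [pred y | col_of y == col_of x]].

Definition row_stab t : {set 'S_n} :=
  [set s : 'S_n | [forall x, s @: row_set t x == row_set t x]].
Definition col_stab t : {set 'S_n} :=
  [set s : 'S_n | [forall x, s @: col_set t x == col_set t x]].

Fact tab_quot_inj t s : injective (fun u => val t (tab_inv s u)).
Proof. by move=> u v /tableau_inj /(congr1 (val s)); rewrite !tab_invK. Qed.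

(* t ∘ s^{-1}; rho_t is [tab_quot t t0] and d_t is [tab_quot t (row_reading lam)]. *)
Definition tab_quot t s : 'S_n := perm (@tab_quot_inj t s).

End Tableau.

(* The tableau t^lambda. *)
Section RowReading.
Context (n : nat) (lam : intpart n).

Fact row_reading_lt (x : node lam) : (flatten_index lam (row_of x) (col_of x) < n)%N.
Proof. by apply: (leq_trans (flatten_indexP (ltn_ord (tagged x)))); rewrite intpart_sum. Qed.

Definition row_reading_fun : {ffun node lam -> 'I_n} :=
  [ffun x => Ordinal (row_reading_lt x)].

Fact row_reading_bij : is_bij row_reading_fun.
Proof.
apply/andP; split.
  apply/injectiveP=> -[i1 j1] [i2 j2]; rewrite !ffunE => /(congr1 val) /= E.
  have Ei : i1 = i2.
    apply: val_inj; rewrite /= -(flatten_indexKl (ltn_ord j1)) /=.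
    by rewrite -[RHS](flatten_indexKl (ltn_ord j2)) /=; congr reshape_index.
  case: i2 / Ei j2 E => j2 E; congr (Tagged _ _); apply: val_inj.
  rewrite /= -(flatten_indexKr (ltn_ord j1)) -[RHS](flatten_indexKr (ltn_ord j2)).
  by congr reshape_offset.
apply/forallP=> u; have ltu : (u < sumn lam)%N by rewrite intpart_sum.
pose i := Ordinal (reshape_indexP ltu).
have ltj : (reshape_offset lam u < nth 0%N lam i)%N by apply: reshape_offsetP.
apply/codomP; exists (Tagged (fun i : 'I_(size lam) => 'I_(nth 0%N lam i)) (Ordinal ltj)).
by apply: val_inj; rewrite ffunE /= /row_of /col_of /= reshape_indexK.
Qed.

Definition row_reading : tableau n lam := Sub row_reading_fun row_reading_bij.

End RowReading.

(* [inl i] is the colour c_{i+1} and [inr j] the colour d_{j+1}. *)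
Definition colour := (nat + nat)%type.

Definition colour_le (c d : colour) : bool :=
  match c, d with
  | inl i, inl j => (i <= j)%N
  | inl _, inr _ => true
  | inr _, inl _ => false
  | inr i, inr j => (i <= j)%N
  end.

Definition is_c (c : colour) : bool := if c is inl _ then true else false.

Section Coloured.
Context (n : nat) (lam : seq nat) (ab : bicomp n).

Definition coloured := {ffun node lam -> colour}.

Definition of_type (T : coloured) : bool :=
  [&& [forall x, match T x with
                 | inl i => (i < size (bca ab))%N
                 | inr j => (j < size (bcb ab))%N
                 end],
      [forall i : 'I_(size (bca ab)),
         #|[pred x | T x == inl (i : nat)]| == nth 0%N (bca ab) i]
    & [forall j : 'I_(size (bcb ab)),
         #|[pred x | T x == inr (j : nat)]| == nth 0%N (bcb ab) j]].

Definition semistandard (T : coloured) : bool :=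
  [&& [forall x : node lam, forall y : node lam,
         (row_of x == row_of y) && (col_of x < col_of y)%N ==> colour_le (T x) (T y)],
      [forall x : node lam, forall y : node lam,
         (col_of x == col_of y) && (row_of x < row_of y)%N ==> colour_le (T x) (T y)],
      [forall x : node lam, forall y : node lam,
         [&& x != y, row_of x == row_of y & T x == T y] ==> is_c (T x)]
    & [forall x : node lam, forall y : node lam,
         [&& x != y, col_of x == col_of y & T x == T y] ==> ~~ is_c (T x)]].

Definition sstd (T : coloured) : bool := of_type T && semistandard T.

Context (t0 : tableau n lam).

Definition label_colour (u : nat) : colour :=
  if (u < sumn (bca ab))%N then inl (reshape_index (bca ab) u)
  else inr (reshape_index (bcb ab) (u - sumn (bca ab))).

Definition T0 : coloured := [ffun x => label_colour (val t0 x)].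

Definition tab_act (s : 'S_n) (T : coloured) : coloured :=
  [ffun x => T (tab_inv t0 (s^-1%g (val t0 x)))].

Definition T_ (d : 'S_n) : coloured := tab_act d T0.

Definition Gamma_sstd (Gamma : {set 'S_n}) : {set 'S_n} :=
  [set d in Gamma | sstd (T_ d)].

Definition Rset : {set 'S_n} :=
  [set d : 'S_n | [set d^-1%g ∘ r ∘ d | r in row_stab t0] :&: youngAB ab
                  \subset youngA ab].

Definition double_coset (d : 'S_n) : {set 'S_n} :=
  [set r ∘ d ∘ h | r in row_stab t0, h in youngAB ab].

(* [epsilon d x] is the sign of xi_beta for any decomposition
   x = r d xi_alpha xi_beta^{+|alpha|}; see [epsilonE] for well-definedness
   when d is in [Rset].  The value is 0 outside the double coset. *)
Definition epsilon (d x : 'S_n) : int :=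
  if [pick p : 'S_n * 'S_(sumn (bca ab)) * 'S_(sumn (bcb ab)) |
        [&& p.1.1 \in row_stab t0, p.1.2 \in young _ (bca ab),
            p.2 \in young _ (bcb ab)
          & x == p.1.1 ∘ d ∘ shiftA p.1.2 ∘ shiftB p.2]] is Some p
  then psgn p.2 else 0.

Definition coef_a (d0 d : 'S_n) : int :=
  \sum_(s in col_stab t0 | s ∘ d0 \in double_coset d) psgn s * epsilon d (s ∘ d0).

End Coloured.

Section Specht.
Context (n : nat) (lam : intpart n).

Definition lam_coset := {X : {set 'S_n} | X \in left_cosets (young n lam)}.

Definition perm_mod := {ffun lam_coset -> int}.
HB.instance Definition _ := GRing.Zmodule.on perm_mod.

Definition pm_basis (X : {set 'S_n}) : perm_mod := [ffun Y => (val Y == X)%:R].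

Definition pm_act (s : 'S_n) (f : perm_mod) : perm_mod :=
  \sum_(X : lam_coset) pm_basis (left_coset s (val X)) *~ f X.

Definition polytabloid (t : tableau n lam) : perm_mod :=
  \sum_(s in col_stab t)
    pm_basis (left_coset (s ∘ tab_quot t (row_reading lam)) (young n lam)) *~ psgn s.

Definition in_specht (f : perm_mod) : Prop :=
  exists c : tableau n lam -> int, f = \sum_t polytabloid t *~ c t.

Definition specht_pred : {pred perm_mod} := fun f => `[< in_specht f >].

Fact specht_zmod_closed : zmod_closed specht_pred.
Proof.
split; first by apply/asboolP; exists (fun=> 0); rewrite big1 // => t _; rewrite mulr0z.
move=> f g /asboolP[c ->] /asboolP[d ->]; apply/asboolP; exists (fun t => c t - d t).
by rewrite -sumrB; apply: eq_bigr => t _; rewrite mulrzBr.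
Qed.
HB.instance Definition _ := GRing.isZmodClosed.Build perm_mod specht_pred specht_zmod_closed.

Record specht := Specht { specht_val :> perm_mod; _ : specht_val \in specht_pred }.
HB.instance Definition _ := [isSub for specht_val].
HB.instance Definition _ := [Choice of specht by <:].
HB.instance Definition _ := [SubChoice_isSubZmodule of specht by <:].

End Specht.

Lemma left_cosetE (n : nat) (s : 'S_n) (H : {set 'S_n}) : left_coset s H = (H :* s)%g.
Proof. by rewrite -rcosetE. Qed.

Fact young_group_set (m : nat) (mu : seq nat) : group_set (young m mu).
Proof.
apply/group_setP; split; first by rewrite inE; apply/forallP=> x; rewrite perm1.
move=> s t; rewrite !inE => /forallP hs /forallP ht; apply/forallP=> x.
by rewrite permM (eqP (ht _)).
Qed.
Canonical young_group m mu := Group (young_group_set m mu).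

Lemma psgnM (m : nat) (s t : 'S_m) : psgn (s * t)%g = psgn s * psgn t.
Proof. by rewrite /psgn odd_permM signr_addb. Qed.
Lemma psgnV (m : nat) (s : 'S_m) : psgn s^-1%g = psgn s.
Proof. by rewrite /psgn odd_permV. Qed.
Lemma psgn2 (m : nat) (s : 'S_m) : psgn s * psgn s = 1.
Proof. by rewrite -expr2 sqrr_sign. Qed.
Lemma psgnJ (m : nat) (s t : 'S_m) : psgn (s ^ t)%g = psgn s.
Proof. by rewrite /psgn odd_permJ. Qed.

Section BicompFacts.
Context (n : nat) (ab : bicomp n).
Local Notation a := (sumn (bca ab)).
Local Notation b := (sumn (bcb ab)).
Implicit Types (xa : 'S_a) (xb : 'S_b).

Lemma shiftAM : {morph @shiftA n ab : s t / (s * t)%g}.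
Proof. exact: shiftM. Qed.
Lemma shiftBM : {morph @shiftB n ab : s t / (s * t)%g}.
Proof. exact: shiftM. Qed.

Lemma shiftA_lt xa (x : 'I_n) : (x < a)%N -> (shiftA xa x < a)%N.
Proof.
move=> ltx; rewrite (@shiftE n 0 a (bca_leq ab) xa (Ordinal ltx) x) //.
by rewrite add0n.
Qed.
Lemma shiftA_id xa (x : 'I_n) : (a <= x)%N -> shiftA xa x = x.
Proof. by move=> lex; apply: shift_id; rewrite add0n -leqNgt. Qed.
Lemma shiftB_id xb (x : 'I_n) : (x < a)%N -> shiftB xb x = x.
Proof. by move=> lex; apply: shift_id; rewrite negb_and -ltnNge lex. Qed.
Lemma shiftB_ge xb (x : 'I_n) : (a <= x)%N -> (a <= shiftB xb x)%N.
Proof.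
move=> lex; have ltx : (x - a < b)%N by rewrite ltn_subLR // bicomp_sum.
rewrite (@shiftE n a b (bcb_leq ab) xb (Ordinal ltx) x) ?leq_addr //=.
by rewrite subnKC.
Qed.

Lemma shiftABC xa xb : commute (shiftA xa) (shiftB xb).
Proof.
apply/permP=> x; rewrite !permM; case: (ltnP x a) => hx.
  by rewrite !shiftB_id // shiftA_lt.
by rewrite !shiftA_id // shiftB_ge.
Qed.

Lemma shiftB_inj xb xb' : (forall x : 'I_n, (a <= x)%N -> shiftB xb x = shiftB xb' x) -> xb = xb'.
Proof.
move=> E; apply/permP=> y.
have lty : (a + y < n)%N by rewrite -[X in (_ < X)%N](bicomp_sum ab) ltn_add2l.
have := E (Ordinal lty) (leq_addr _ _); move/(congr1 val).
rewrite /= !(@shiftE n a b (bcb_leq ab) _ y (Ordinal lty)) //.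
by move/addnI/val_inj.
Qed.

Definition shAB xa xb : 'S_n := shiftA xa ∘ shiftB xb.

Lemma shABM xa xb xa' xb' : (shAB xa xb * shAB xa' xb' = shAB (xa * xa') (xb * xb'))%g.
Proof.
rewrite /shAB shiftAM shiftBM !mulgA; congr (_ * _)%g.
by rewrite -!mulgA; congr (_ * _)%g; rewrite shiftABC.
Qed.

Lemma shiftA1 : shiftA (1 : 'S_a)%g = 1%g :> 'S_n.
Proof. by apply: (mulgI (shiftA (1 : 'S_a)%g)); rewrite -shiftAM !mulg1. Qed.
Lemma shiftB1 : shiftB (1 : 'S_b)%g = 1%g :> 'S_n.
Proof. by apply: (mulgI (shiftB (1 : 'S_b)%g)); rewrite -shiftBM !mulg1. Qed.
Lemma shAB1 : shAB 1%g 1%g = 1%g.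
Proof. by rewrite /shAB shiftA1 shiftB1 mulg1. Qed.
Lemma shABV xa xb : ((shAB xa xb)^-1 = shAB xa^-1 xb^-1)%g.
Proof. by apply: (mulgI (shAB xa xb)); rewrite mulgV shABM !mulgV shAB1. Qed.

Lemma shAB_injB xa xb xa' xb' : shAB xa xb = shAB xa' xb' -> xb = xb'.
Proof.
move=> E; apply: shiftB_inj => x hx; move/permP: E => /(_ x).
by rewrite !permM !shiftA_id // shiftB_ge.
Qed.

Lemma shAB_injA xa xb xa' xb' : shAB xa xb = shAB xa' xb' -> xa = xa'.
Proof.
move=> E; have Eb := shAB_injB E; move: E; rewrite /shAB Eb => /mulgI E.
apply/permP=> y.
have lty : (y < n)%N by apply: leq_trans (bca_leq ab).
move/permP: E => /(_ (Ordinal lty)) /(congr1 val).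
by rewrite /= !(@shiftE n 0 a (bca_leq ab) _ y (Ordinal lty)) // => /val_inj.
Qed.

Lemma youngABP x : reflect (exists xa xb, [/\ xa \in young a (bca ab), xb \in young b (bcb ab)
   & x = shAB xa xb]) (x \in youngAB ab).
Proof.
apply: (iffP imset2P) => [[xa xb ha hb ->] | [xa [xb [ha hb ->]]]].
  by exists xa, xb.
by exists xa xb.
Qed.

Fact youngAB_group_set : group_set (youngAB ab).
Proof.
apply/group_setP; split.
  by apply/youngABP; exists 1%g, 1%g; rewrite !group1 shAB1.
move=> x y /youngABP[xa [xb [ha hb ->]]] /youngABP[xa' [xb' [ha' hb' ->]]].
by apply/youngABP; exists (xa * xa')%g, (xb * xb')%g; rewrite !groupM // shABM.
Qed.
Canonical youngAB_group := Group youngAB_group_set.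

End BicompFacts.
Arguments shAB {n} ab xa xb.

Section TableauFacts.
Context (n : nat) (lam : seq nat).
Implicit Types (s t : tableau n lam) (u v : 'S_n).

Fact tab_move_bij u t : is_bij [ffun x => u (val t x)].
Proof.
apply/andP; split.
  by apply/injectiveP=> x y; rewrite !ffunE => /perm_inj/tableau_inj.
apply/forallP=> v; apply/codomP; exists (tab_inv t (u^-1%g v)).
by rewrite ffunE tab_invK permKV.
Qed.

Definition tab_move u t : tableau n lam := Sub [ffun x => u (val t x)] (tab_move_bij u t).

Lemma tab_moveE u t x : val (tab_move u t) x = u (val t x).
Proof. by rewrite ffunE. Qed.

Lemma tab_moveM u v t : tab_move (u ∘ v) t = tab_move u (tab_move v t).
Proof. by apply: val_inj; apply/ffunP=> x; rewrite !tab_moveE permM. Qed.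

Lemma tab_move1 t : tab_move 1%g t = t.
Proof. by apply: val_inj; apply/ffunP=> x; rewrite !tab_moveE perm1. Qed.

Lemma tab_quotE t s x : tab_quot t s (val s x) = val t x.
Proof. by rewrite permE tabK. Qed.

Lemma tab_moveK t s : tab_move (tab_quot t s) s = t.
Proof. by apply: val_inj; apply/ffunP=> x; rewrite tab_moveE tab_quotE. Qed.

Lemma tab_quot_move u t s : tab_quot (tab_move u t) s = u ∘ tab_quot t s.
Proof. by apply/permP=> x; rewrite permM !permE tab_moveE. Qed.

Lemma tab_quotM t s r : tab_quot t s ∘ tab_quot s r = tab_quot t r.
Proof. by rewrite -tab_quot_move tab_moveK. Qed.

Lemma row_set_move u t x : row_set (tab_move u t) x = u @: row_set t x.
Proof. by rewrite -imset_comp; apply: eq_imset => y /=; rewrite ffunE. Qed.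
Lemma col_set_move u t x : col_set (tab_move u t) x = u @: col_set t x.
Proof. by rewrite -imset_comp; apply: eq_imset => y /=; rewrite ffunE. Qed.

Let imJ u v (A : {set 'I_n}) : ((u ^ v)%g @: (v @: A) == v @: A) = (u @: A == A).
Proof.
rewrite -[X in X == _]imset_comp (eq_imset (g := v \o u)); last first.
  by move=> y /=; rewrite permJ.
by rewrite imset_comp; apply/eqP/eqP => [/(imset_inj (@perm_inj _ v))|->].
Qed.

Lemma row_stab_move u v t : ((v ^ u)%g \in row_stab (tab_move u t)) = (v \in row_stab t).
Proof. by rewrite !inE; apply: eq_forallb => x; rewrite row_set_move imJ. Qed.
Lemma col_stab_move u v t : ((v ^ u)%g \in col_stab (tab_move u t)) = (v \in col_stab t).
Proof. by rewrite !inE; apply: eq_forallb => x; rewrite col_set_move imJ. Qed.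

Let im1 (A : {set 'I_n}) : (1 : 'S_n)%g @: A = A.
Proof. by rewrite -[RHS]imset_id; apply: eq_imset => x; rewrite perm1. Qed.
Let imM u v (A : {set 'I_n}) : (u * v)%g @: A = v @: (u @: A).
Proof. by rewrite -imset_comp; apply: eq_imset => x /=; rewrite permM. Qed.

Fact row_stab_group_set t : group_set (row_stab t).
Proof.
apply/group_setP; split; first by rewrite inE; apply/forallP=> x; rewrite im1.
move=> u v; rewrite !inE => /forallP hu /forallP hv; apply/forallP=> x.
by rewrite imM (eqP (hu x)).
Qed.
Canonical row_stab_group t := Group (row_stab_group_set t).

Fact col_stab_group_set t : group_set (col_stab t).
Proof.
apply/group_setP; split; first by rewrite inE; apply/forallP=> x; rewrite im1.
move=> u v; rewrite !inE => /forallP hu /forallP hv; apply/forallP=> x.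
by rewrite imM (eqP (hu x)).
Qed.
Canonical col_stab_group t := Group (col_stab_group_set t).

Lemma row_stabP t u :
  reflect (forall y, row_of (tab_inv t (u (val t y))) = row_of y) (u \in row_stab t).
Proof.
rewrite inE; apply: (iffP forallP) => [h y|h x].
  have : u (val t y) \in row_set t y.
    by rewrite -(eqP (h y)) imset_f //; apply/imsetP; exists y; rewrite ?inE.
  by case/imsetP=> z; rewrite inE => /eqP Ez ->; rewrite tabK.
rewrite eqEcard card_imset ?leqnn ?andbT; last exact: perm_inj.
apply/subsetP=> _ /imsetP[_ /imsetP[y hy ->] ->].
apply/imsetP; exists (tab_inv t (u (val t y))); last by rewrite tab_invK.
by move: hy; rewrite !inE h.
Qed.

End TableauFacts.

Lemma row_stab_reading (n : nat) (lam : intpart n) :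
  row_stab (row_reading lam) = young n lam.
Proof.
have key (y : node lam) : reshape_index lam (val (row_reading lam) y) = row_of y.
  by rewrite /= ffunE /=; apply: flatten_indexKl; apply: ltn_ord.
apply/setP=> s; apply/row_stabP/idP=> [h|].
  rewrite inE; apply/forallP=> x.
  rewrite -(tab_invK (row_reading lam) x); set y := tab_inv _ x.
  by rewrite -(tab_invK (row_reading lam) (s _)) !key h.
rewrite inE => /forallP h y.
by rewrite -!key tab_invK; apply/eqP; apply: h.
Qed.

Lemma ffun_mulrzE (T : finType) (f : {ffun T -> int}) (k : int) (t : T) :
  (f *~ k) t = f t * k.
Proof.
case: k => k; first by rewrite -pmulrn ffunMnE -mulr_natr natz.
by rewrite NegzE mulrNz ffunE -pmulrn ffunMnE mulrN -mulr_natr natz.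
Qed.

Section SpechtFacts.
Context (n : nat) (lam : intpart n).
Local Notation Y := (young n lam).
Local Notation M := (perm_mod lam).
Local Notation coset_of y := (left_coset y Y).

Lemma left_cosetM (s y : 'S_n) (H : {set 'S_n}) :
  left_coset s (left_coset y H) = left_coset (s ∘ y) H.
Proof. by rewrite !left_cosetE rcosetM. Qed.

Fact pm_act_is_zmod_morphism s : zmod_morphism (@pm_act n lam s).
Proof.
move=> f g; rewrite /pm_act -sumrB; apply: eq_bigr => X _.
by rewrite !ffunE mulrzBr.
Qed.
HB.instance Definition _ s :=
  GRing.isZmodMorphism.Build M M (@pm_act n lam s) (pm_act_is_zmod_morphism s).

Lemma pm_actMz s (f : M) k : pm_act s (f *~ k) = pm_act s f *~ k.
Proof. exact: (raddfMz (@pm_act n lam s)). Qed.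

Lemma pm_act_basis s y :
  pm_act s (pm_basis lam (coset_of y)) = pm_basis lam (coset_of (s ∘ y)).
Proof.
have hy : coset_of y \in left_cosets Y by apply: imset_f.
pose X0 : lam_coset lam := Sub (coset_of y) hy.
rewrite /pm_act (bigD1 X0) //= ffunE eqxx big1 ?addr0 ?left_cosetM //.
by move=> X; rewrite -val_eqE ffunE /= => /negPf->.
Qed.

Lemma pm_act_polytabloid s (t : tableau n lam) : pm_act s (polytabloid t) = polytabloid (tab_move s t).
Proof.
rewrite /polytabloid raddf_sum [RHS](reindex_inj (conjg_inj s)) /=.
apply: eq_big => [u|u _]; first by rewrite col_stab_move.
rewrite pm_actMz pm_act_basis psgnJ tab_quot_move.
by rewrite -mulgA (conjgC u s) mulgA.
Qed.

Lemma specht_act_subproof s (x : specht lam) : pm_act s x \in @specht_pred n lam.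
Proof.
case: x => f /= /asboolP[c ->]; apply/asboolP.
exists (fun t => c (tab_move s^-1%g t)).
rewrite raddf_sum [RHS](reindex_onto (tab_move s) (tab_move s^-1%g)) /=; last first.
  by move=> t _; rewrite -tab_moveM mulVg tab_move1.
apply: eq_big => [t|t _]; first by rewrite -tab_moveM mulgV tab_move1 eqxx.
by rewrite pm_actMz pm_act_polytabloid -tab_moveM mulgV tab_move1.
Qed.

Definition specht_act s (x : specht lam) : specht lam := Specht (specht_act_subproof s x).

Lemma specht_e_subproof (t : tableau n lam) : polytabloid t \in @specht_pred n lam.
Proof.
apply/asboolP; exists (fun u => (u == t)%:R).
by rewrite (bigD1 t) //= eqxx big1 ?addr0 // => u /negPf->; rewrite mulr0z.
Qed.

Definition specht_e (t : tableau n lam) : specht lam := Specht (specht_e_subproof t).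

Lemma specht_span (x : specht lam) :
  exists c : tableau n lam -> int, x = \sum_t specht_e t *~ c t.
Proof.
case: (x) (erefl x) => f hf Ex; have /asboolP[c Ec] := hf; exists c.
apply: val_inj; rewrite raddf_sum /= Ec; apply: eq_bigr => t _.
by rewrite -[RHS]/(val (specht_e t *~ c t)) raddfMz.
Qed.

Lemma specht_act_e s (t : tableau n lam) : specht_act s (specht_e t) = specht_e (tab_move s t).
Proof. by apply: val_inj; rewrite /= pm_act_polytabloid. Qed.

End SpechtFacts.

(* The free Z-module on the basis {d ⊗ 1 ⊗ ϵ : d in Gamma}; [ab] only enters
   through the action [ind_act]. *)
Definition ind_mod (n : nat) (ab : bicomp n) (Gamma : {set 'S_n}) :=
  {ffun {d | d \in Gamma} -> int}.
HB.instance Definition _ n (ab : bicomp n) Gamma :=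
  GRing.Zmodule.on (ind_mod ab Gamma).

Section Induced.
Context (n : nat) (ab : bicomp n) (Gamma : {set 'S_n}).
Local Notation M := (ind_mod ab Gamma).

(* The element x ⊗ 1 ⊗ ϵ for arbitrary x: it is sgn(xi_beta) (d ⊗ 1 ⊗ ϵ) for the
   unique d in Gamma, xi_alpha, xi_beta with x = d xi_alpha xi_beta^{+|alpha|}. *)
Definition ind_vec (x : 'S_n) : M :=
  [ffun d : {d | d \in Gamma} =>
     \sum_(p : 'S_(sumn (bca ab)) * 'S_(sumn (bcb ab)) |
           [&& p.1 \in young _ (bca ab), p.2 \in young _ (bcb ab)
             & x == val d ∘ shiftA p.1 ∘ shiftB p.2]) psgn p.2].

Definition ind_act (s : 'S_n) (m : M) : M :=
  \sum_(d : {d | d \in Gamma}) ind_vec (s ∘ val d) *~ m d.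

(* The image of m in Q ⊗ M(alpha|beta). *)
Definition ind_rat (m : M) : {ffun {d | d \in Gamma} -> rat^o} :=
  [ffun d => (m d)%:~R].

Fact ind_act_is_zmod_morphism s : zmod_morphism (ind_act s).
Proof.
move=> f g; rewrite /ind_act -sumrB; apply: eq_bigr => d _.
by rewrite !ffunE mulrzBr.
Qed.
HB.instance Definition _ s :=
  GRing.isZmodMorphism.Build M M (ind_act s)
    (ind_act_is_zmod_morphism s).

Section Facts.
Context (HG : left_transversal (youngAB ab) Gamma).
Local Notation Ya := (young (sumn (bca ab)) (bca ab)).
Local Notation Yb := (young (sumn (bcb ab)) (bcb ab)).
Local Notation G := {d | d \in Gamma}.

Lemma transversal_ex x : exists (g : G) xa xb,
  [/\ xa \in Ya, xb \in Yb & x = val g ∘ shAB ab xa xb].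
Proof.
case/and3P: HG => _ _ /forall_inP/(_ (left_coset x (youngAB ab)) (imset_f _ _)).
case/(_ isT)/cards1P=> g Eg.
have : g \in Gamma :&: left_coset x (youngAB ab) by rewrite Eg set11.
rewrite inE left_cosetE => /andP[hg /rcosetP[h hh Eh]].
have /youngABP[xa [xb [ha hb E]]] : (h^-1)%g \in youngAB ab by rewrite groupV.
exists (Sub g hg : G), xa, xb; split=> //=.
by rewrite -E Eh mulKg.
Qed.

Lemma transversal_uniq (g g' : G) h h' : h \in youngAB ab -> h' \in youngAB ab ->
  val g ∘ h = val g' ∘ h' -> g = g'.
Proof.
move=> hh hh' E; apply: val_inj.
case/and3P: HG => _ _ /forall_inP/(_ (left_coset (val g) (youngAB ab)) (imset_f _ _)).
case/(_ isT)/cards1P=> g0 Eg.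
have h1 : val g \in Gamma :&: left_coset (val g) (youngAB ab).
  by rewrite inE (valP g) left_cosetE rcoset_refl.
have h2 : val g' \in Gamma :&: left_coset (val g) (youngAB ab).
  rewrite inE (valP g') left_cosetE; apply/rcosetP; exists (h'^-1 * h)%g.
    by rewrite groupM ?groupV.
  by rewrite -mulgA E mulKg.
by move: h1 h2; rewrite Eg !inE => /eqP-> /eqP->.
Qed.

Lemma mem_shAB xa xb : xa \in Ya -> xb \in Yb -> shAB ab xa xb \in youngAB ab.
Proof. by move=> ha hb; apply/youngABP; exists xa, xb. Qed.

Lemma ind_vecE (g g' : G) xa xb : xa \in Ya -> xb \in Yb ->
  ind_vec (val g ∘ shAB ab xa xb) g' = if g' == g then psgn xb else 0.
Proof.
move=> ha hb; rewrite ffunE; case: eqP => [->|ne].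
  rewrite (big_pred1 (xa, xb)) // => -[pa pb] /=.
  rewrite mulgA (inj_eq (mulIg _)); apply/and3P/eqP => [[_ _ /eqP E]|[-> ->]].
    by rewrite (shAB_injA E) (shAB_injB E).
  by split.
rewrite big1 // => -[pa pb] /= /and3P[hpa hpb /eqP E]; case: ne.
apply: esym; apply: (transversal_uniq (mem_shAB ha hb) (mem_shAB hpa hpb)).
by rewrite E mulgA.
Qed.

Lemma ind_vec_basis (g g' : G) : ind_vec (val g) g' = (g' == g)%:R.
Proof.
have := @ind_vecE g g' 1%g 1%g (group1 _) (group1 _).
by rewrite shAB1 mul1g => ->; case: eqP => // _; rewrite /psgn odd_perm1.
Qed.

Lemma ind_vecM x xa xb : xa \in Ya -> xb \in Yb ->
  ind_vec (x ∘ shiftA xa ∘ shiftB xb) = ind_vec x *~ psgn xb.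
Proof.
move=> ha hb; have [g [ya [yb [hya hyb ->]]]] := transversal_ex x.
apply/ffunP=> g'; rewrite mulgA -/(shAB ab xa xb) mulgA shABM.
rewrite ind_vecE ?groupM //.
rewrite ffun_mulrzE ind_vecE //; case: eqP => _; last by rewrite mul0r.
by rewrite psgnM mulrC.
Qed.

Lemma ind_act_vec s x : ind_act s (ind_vec x) = ind_vec (s ∘ x).
Proof.
have [g [xa [xb [ha hb ->]]]] := transversal_ex x.
have E : ind_act s (ind_vec (val g)) = ind_vec (s ∘ val g).
  rewrite /ind_act (bigD1 g) //= ind_vec_basis eqxx big1 ?addr0 //.
  by move=> g' /negPf ne; rewrite ind_vec_basis ne.
have -> : s ∘ (val g ∘ shAB ab xa xb) = (s ∘ val g) ∘ shiftA xa ∘ shiftB xb.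
  by rewrite /shAB !mulgA.
rewrite ind_vecM // -E /shAB -mulgA ind_vecM //.
exact: (raddfMz (ind_act s)).
Qed.

Lemma ind_act_coord s (F : 'S_n -> int) (g : G) :
  (forall x xa xb, xa \in Ya -> xb \in Yb -> F (x ∘ shAB ab xa xb) = psgn xb * F x) ->
  ind_act s [ffun g' : G => F (val g')] g = F (s^-1%g ∘ val g).
Proof.
move=> hF.
have [g0 [xa [xb [ha hb E]]]] := transversal_ex (s^-1%g ∘ val g).
have Ex : val g0 = s^-1%g ∘ val g ∘ shAB ab xa^-1%g xb^-1%g by rewrite E -shABV mulKg.
rewrite sum_ffunE (bigD1 g0) //= [X in _ + X]big1 ?addr0.
  rewrite ffun_mulrzE [X in _ * X]ffunE.
  have -> : s ∘ val g0 = val g ∘ shAB ab xa^-1%g xb^-1%g by rewrite Ex -!mulgA mulVg mulg1.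
  by rewrite ind_vecE ?groupV // eqxx Ex hF ?groupV // mulrA psgn2 mul1r.
move=> g' ne; rewrite ffun_mulrzE.
have [g1 [ya [yb [hya hyb E1]]]] := transversal_ex (s ∘ val g').
rewrite E1 ind_vecE //; case: eqP => [Eg|]; last by rewrite mul0r.
case/eqP: ne; apply: (transversal_uniq (h := (shAB ab ya yb)^-1%g) _ (mem_shAB ha hb)).
  by rewrite groupV mem_shAB.
apply: (mulIg s); rewrite -E -[LHS]mulgA E1 -[RHS]mulgA mulVg mulg1.
by rewrite -Eg mulKg.
Qed.

End Facts.
End Induced.

Section Homs.
Context (n : nat) (lam : intpart n) (ab : bicomp n) (t0 : tableau n lam).
Context (Gamma : {set 'S_n}).
Local Notation S := (specht lam).
Local Notation M := (ind_mod ab Gamma).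
Local Notation a := (sumn (bca ab)).
Local Notation b := (sumn (bcb ab)).
Local Notation Ya := (young a (bca ab)).
Local Notation Yb := (young b (bcb ab)).
Local Notation G := {d | d \in Gamma}.

Definition is_hom (f : {additive S -> M}) : Prop :=
  forall s x, f (specht_act s x) = ind_act s (f x).

Definition is_theta_hat (d : 'S_n) (f : {additive S -> M}) : Prop :=
  is_hom f /\
  forall t : tableau n lam,
    f (specht_e t) =
      \sum_(g : G) ind_vec ab Gamma (val g)
                     *~ coef_a ab t0 ((tab_quot t t0)^-1%g ∘ val g) d.

(* Well-defined for d in [Rset] by [theta_hat_ex] and [theta_hat_uniq]. *)
Definition theta_hat (d : 'S_n) : {additive S -> M} :=
  if pselect (exists f, is_theta_hat d f) is left h then projT1 (cid h) else \0.

Lemma theta_hat_uniq d f f' : is_theta_hat d f -> is_theta_hat d f' -> f =1 f'.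
Proof.
move=> [_ E] [_ E'] x; have [c ->] := specht_span x.
by rewrite !raddf_sum; apply: eq_bigr => t _; rewrite !raddfMz E E'.
Qed.

Local Notation R0 := (row_stab t0).
Local Notation eps := (epsilon ab t0).
Local Notation Rs := (Rset ab t0).

Lemma epsilonE d r xa xb : d \in Rs -> r \in R0 -> xa \in Ya -> xb \in Yb ->
  eps d (r ∘ d ∘ shAB ab xa xb) = psgn xb.
Proof.
rewrite inE => /subsetP hd hr ha hb; rewrite /epsilon; case: pickP => [p|]; last first.
  by move/(_ (r, xa, xb)); rewrite /= hr ha hb /= /shAB -!mulgA eqxx.
case: p => -[r' ya] yb /= /and4P[hr' hya hyb] /eqP E0.
have E : (shAB ab xa xb * (d * r) = shAB ab ya yb * (d * r'))%g.
  by rewrite E0 /shAB -!mulgA.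
have gen (hx hy : 'S_n) : (hx * (d * r) = hy * (d * r') ->
    hy^-1 * hx = d * (r' * r^-1 * d^-1))%g.
  move=> Exy; apply: (mulgI hy); rewrite mulKVg; apply: (mulIg (d * r)%g).
  by rewrite Exy -!mulgA mulKg mulVg mulg1.
have hin : ((shAB ab ya yb)^-1 * shAB ab xa xb)%g \in youngA ab.
  apply: hd; rewrite inE [X in _ && X]groupM ?groupV ?mem_shAB // andbT (gen _ _ E).
  by apply/imsetP; exists (r' * r^-1)%g; rewrite ?groupM ?groupV.
case/imsetP: hin => z _; rewrite shABV shABM => Ez.
have Ez' : shAB ab (ya^-1 * xa)%g (yb^-1 * xb)%g = shAB ab z 1%g.
  by rewrite Ez /shAB shiftB1 mul1g.
have /eqP := shAB_injB Ez'.
by rewrite -eq_invg_mul invgK => /eqP->.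
Qed.

Lemma epsilon0 d x : eps d x != 0 -> exists r xa xb,
  [/\ r \in R0, xa \in Ya, xb \in Yb & x = r ∘ d ∘ shAB ab xa xb].
Proof.
rewrite /epsilon; case: pickP => [[[r xa] xb] /= /and4P[hr ha hb /eqP ->] _|_]; last by rewrite eqxx.
by exists r, xa, xb; rewrite /shAB !mulgA.
Qed.

Lemma epsilonM d r x xa xb : d \in Rs -> r \in R0 -> xa \in Ya -> xb \in Yb ->
  eps d (r ∘ x ∘ shAB ab xa xb) = psgn xb * eps d x.
Proof.
move=> hd hr ha hb.
have base y s ya yb : s \in R0 -> ya \in Ya -> yb \in Yb -> eps d y != 0 ->
    eps d (s ∘ y ∘ shAB ab ya yb) = psgn yb * eps d y.
  move=> hs hya hyb /epsilon0[r' [za [zb [hr' hza hzb ->]]]].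
  rewrite epsilonE //.
  have gen (u v : 'S_n) : u ∘ (r' ∘ d ∘ v) = (u ∘ r') ∘ d ∘ v by rewrite !mulgA.
  by rewrite gen mulgA shABM epsilonE ?groupM // psgnM.
have [E|] := eqVneq (eps d x) 0; last exact: base.
rewrite E mulr0; apply/eqP/contraT=> ne.
have := base _ r^-1%g xa^-1%g xb^-1%g _ _ _ ne; rewrite !groupV => /(_ hr ha hb).
have gen (u : 'S_n) : r^-1%g ∘ (r ∘ x ∘ u) ∘ u^-1%g = x by rewrite -!mulgA mulKg mulgV mulg1.
rewrite -shABV gen E => /esym/eqP; rewrite mulf_eq0 (negPf ne) orbF.
by rewrite /psgn signr_eq0.
Qed.

Lemma mem_double_coset d x : d \in Rs -> (x \in double_coset ab t0 d) = (eps d x != 0).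
Proof.
move=> hd; apply/imset2P/idP => [[r h hr /youngABP[xa [xb [ha hb ->]]] ->]|].
  by rewrite epsilonE // /psgn signr_eq0.
case/epsilon0=> r [xa [xb [hr ha hb ->]]].
by exists r (shAB ab xa xb) => //; apply: mem_shAB.
Qed.

Let w := tab_quot t0 (row_reading lam).

(* The homomorphism M^lambda -> M(alpha|beta) inducing theta_hat, in coordinates. *)
Definition theta_co (d x : 'S_n) (f : perm_mod lam) : int :=
  \sum_(X : lam_coset lam) eps d (w ∘ (repr (val X))^-1%g ∘ x) * f X.

Fact theta_co_is_zmod_morphism d x : zmod_morphism (theta_co d x).
Proof.
move=> f f'; rewrite /theta_co -sumrB; apply: eq_bigr => X _.
by rewrite -mulrBr !ffunE.
Qed.
HB.instance Definition _ d x :=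
  GRing.isZmodMorphism.Build (perm_mod lam) int (theta_co d x)
    (theta_co_is_zmod_morphism d x).

Lemma theta_coMz d x f k : theta_co d x (f *~ k) = theta_co d x f * k.
Proof. by rewrite (raddfMz (theta_co d x)) mulrzz. Qed.

Lemma theta_co_sum d x (I : finType) (P : pred I) (F : I -> perm_mod lam) :
  theta_co d x (\sum_(i | P i) F i) = \sum_(i | P i) theta_co d x (F i).
Proof. exact: (raddf_sum (theta_co d x)). Qed.

Definition theta_fun (d : 'S_n) (f : S) : M :=
  [ffun g : G => theta_co d (val g) (specht_val f)].

Fact theta_fun_is_zmod_morphism d : zmod_morphism (theta_fun d).
Proof.
move=> f f'; apply/ffunP=> g; rewrite !ffunE.
exact: (raddfB (theta_co d (val g))).
Qed.
HB.instance Definition _ d :=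
  GRing.isZmodMorphism.Build S M (theta_fun d) (theta_fun_is_zmod_morphism d).

Lemma w_young u : u \in young n lam -> (u ^ w)%g \in R0.
Proof.
by move=> hu; rewrite -(tab_moveK t0 (row_reading lam)) row_stab_move row_stab_reading.
Qed.

Lemma repr_lam_coset (X : lam_coset lam) : val X = left_coset (repr (val X)) (young n lam).
Proof.
by case: X => X /= /imsetP[y _ ->]; rewrite !left_cosetE rcoset_repr.
Qed.

Lemma theta_co_basis d x y : d \in Rs ->
  theta_co d x (pm_basis lam (left_coset y (young n lam))) = eps d (w ∘ y^-1%g ∘ x).
Proof.
move=> hd; have hy : left_coset y (young n lam) \in left_cosets (young n lam) by apply: imset_f.
pose X0 : lam_coset lam := Sub (left_coset y (young n lam)) hy.
rewrite /theta_co (bigD1 X0) //= [X in _ + X]big1 ?addr0; last first.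
  by move=> X; rewrite -val_eqE ffunE /= => /negPf->; rewrite mulr0.
rewrite ffunE eqxx mulr1; set z := repr _.
have /rcosetP[u hu ->] : z \in (young n lam :* y)%g by rewrite /z left_cosetE mem_repr_rcoset.
have gen (v : 'S_n) : w ∘ (y ∘ v)^-1%g ∘ x = (v^-1 ^ w)%g ∘ (w ∘ y^-1%g ∘ x).
  by rewrite invMg -!mulgA -conjgC.
rewrite gen; have := @epsilonM d (u^-1 ^ w)%g (w ∘ y^-1%g ∘ x) 1%g 1%g hd.
rewrite w_young ?groupV // => /(_ isT (group1 _) (group1 _)).
by rewrite shAB1 mul1g /psgn odd_perm1 mul1r.
Qed.

Lemma coef_aE x d : d \in Rs ->
  coef_a ab t0 x d = \sum_(s in col_stab t0) psgn s * eps d (s ∘ x).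
Proof.
move=> hd; rewrite /coef_a big_mkcondr; apply: eq_bigr => s _.
by rewrite mem_double_coset //; case: eqP => //= ->; rewrite mulr0.
Qed.

Lemma theta_co_e d x (t : tableau n lam) : d \in Rs ->
  theta_co d x (polytabloid t) = coef_a ab t0 ((tab_quot t t0)^-1%g ∘ x) d.
Proof.
move=> hd; rewrite coef_aE // /polytabloid theta_co_sum.
set q := tab_quot t t0.
rewrite (reindex_inj (h := fun s => (s^-1 ^ q)%g)) /=; last first.
  by move=> s s' /conjg_inj/invg_inj.
apply: eq_big => [s|s _].
  by rewrite -[X in _ \in col_stab X](tab_moveK t t0) col_stab_move groupV.
rewrite theta_coMz theta_co_basis // psgnJ psgnV mulrC -(tab_quotM t t0 (row_reading lam)).
congr (_ * eps d _).
by rewrite -/w -/q conjVg !invMg invgK /conjg -!mulgA mulVg !mulg1 !invgK mulgV mulg1.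
Qed.

Context (HG : left_transversal (youngAB ab) Gamma).

Lemma theta_fun_hat d : d \in Rs -> is_theta_hat d (theta_fun d).
Proof.
move=> hd; split=> [s x|t].
  apply/ffunP=> g.
  have -> : ind_act s (theta_fun d x) g = theta_co d (s^-1%g ∘ val g) x.
    apply: (@ind_act_coord _ _ _ HG s (fun y => theta_co d y x) g).
    move=> y xa xb ha hb; rewrite /theta_co mulr_sumr; apply: eq_bigr => X _.
    rewrite mulrA; congr (_ * _).
    have := @epsilonM d 1%g (w ∘ (repr (val X))^-1%g ∘ y) xa xb hd (group1 _) ha hb.
    by rewrite mulg1 !mulgA.
  rewrite ffunE /= /pm_act theta_co_sum; apply: eq_bigr => X _.
  rewrite theta_coMz [in LHS]repr_lam_coset left_cosetM theta_co_basis //.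
  by congr (eps d _ * _); rewrite invMg !mulgA.
apply/ffunP=> g; rewrite ffunE theta_co_e // sum_ffunE (bigD1 g) //= big1 ?addr0.
  by rewrite ffun_mulrzE ind_vec_basis // eqxx mul1r.
by move=> g' /negPf ne; rewrite ffun_mulrzE ind_vec_basis // eq_sym ne mul0r.
Qed.

Lemma theta_hat_ex d : d \in Rs -> exists f, is_theta_hat d f.
Proof. by move=> /theta_fun_hat; exists (theta_fun d). Qed.

Lemma theta_hatP d : d \in Rs -> is_theta_hat d (theta_hat d).
Proof.
move=> /theta_hat_ex h; rewrite /theta_hat; case: pselect => // h'.
exact: projT2 (cid h').
Qed.

Lemma Gamma_sstd_sub : Gamma_sstd ab t0 Gamma \subset Rs.
Proof.
apply/subsetP=> d; rewrite !inE => /andP[_ /andP[_ /and4P[_ _ /forallP hrow _]]].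
apply/subsetP=> z; rewrite inE => /andP[/imsetP[r hr Ez]].
case/youngABP=> xa [xb [ha hb E]].
suff Eb : xb = 1%g by rewrite E Eb /shAB shiftB1 mul1g; apply: imset_f.
apply: (@shiftB_inj n ab) => u hu; rewrite shiftB1 perm1.
have Ezu : z u = shiftB xb u by rewrite E permM shiftA_id // shiftB_ge.
pose y := tab_inv t0 (d u); pose y' := tab_inv t0 (d (z u)).
have Ty v : T_ ab t0 d (tab_inv t0 (d v)) = label_colour ab v.
  by rewrite !ffunE !tab_invK permK.
have Erow : row_of y' = row_of y.
  have Er : d (z u) = r (d u) by rewrite Ez !permM permKV.
  by rewrite /y' Er -[d u](tab_invK t0) (row_stabP _ _ hr).
have Ecol : label_colour ab (z u) = label_colour ab u.
  rewrite /label_colour Ezu !ltnNge shiftB_ge // hu /=; congr inr.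
  have ltu : (u - a < b)%N by rewrite ltn_subLR // bicomp_sum.
  have Eu : val u = (a + Ordinal ltu)%N by rewrite /= subnKC.
  rewrite (shiftE (bcb_leq ab) xb Eu) addKn.
  by move: hb; rewrite inE => /forallP/(_ (Ordinal ltu))/eqP.
have /forallP/(_ y') := hrow y.
rewrite Erow !Ty Ecol !eqxx /= andbT /label_colour ltnNge hu /= implybF negbK.
by move/eqP/(congr1 (val t0)); rewrite !tab_invK Ezu => /perm_inj.
Qed.

End Homs.

(* Main.v *)
Require Import Defs.
From mathcomp Require Import all_boot all_order all_algebra all_fingroup.
From mathcomp Require Import zify ring.
Set Implicit Arguments.
Unset Strict Implicit.
Unset Printing Implicit Defensive.
Import Order.TTheory GRing.Theory Num.Theory.
Local Open Scope ring_scope.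

(* A homomorphism is determined by the image m of the generator e_{t0}, that is by the
   coordinates F(x) of m at x ⊗ 1 ⊗ ϵ.  If F is not zero, take d with F(d) nonzero such that
   T_d has the greatest sum of (column * colour), and then of (row * colour).
   Antisymmetry of e_{t0} under C_{t0} sorts the columns of T_d, and a Garnir relation
   (the signed sum over all permutations of the labels below one node and above another
   kills e_{t0}) shows that a bad pair in a row would force F(d) = 0; so T_d is semistandard.
   Hence the restriction of F to Gamma_sstd determines the homomorphism.
   On the other hand the matrix a_{d',d} with d', d in Gamma_sstd is triangular for the order
   given by the sum of (row * colour), which is invariant under row permutations and maximal
   at column-sorted tableaux, and it has positive diagonal.  So some rational combination of
   the theta_d agrees with the given homomorphism on Gamma_sstd, hence everywhere. *)

(** * Rearrangement inequality for functions sorted on blocks *)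

Section Rearrangement.
Context (n : nat).
Implicit Types (b w T : 'I_n -> nat) (s : 'S_n).

(** Intended for [b] the row and [w] the column of a label, or the other way round, so that both
    monotonicity conditions on a semistandard tableau are instances. *)
Definition block_monotone b w T :=
  forall u v, b u = b v -> (w u < w v)%N -> (T u <= T v)%N.

Definition moment w T := (\sum_u w u * T u)%N.

Lemma moment_perm w T s : moment w (fun u => T (s u)) = moment (fun u => w (s^-1%g u)) T.
Proof.
rewrite /moment (reindex_inj (@perm_inj _ s^-1%g)) /=.
by apply: eq_bigr => u _; rewrite permKV.
Qed.

(** The gain is [(w y - w x) * (T x - T y)], which is positive. *)
Lemma moment_tperm w T x y : (w x < w y)%N -> (T y < T x)%N ->
  (moment w T < moment w (fun u => T (tperm x y u)))%N.
Proof.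
move=> hw hT; have nxy : y != x by apply: contraTneq hw => ->; rewrite ltnn.
rewrite /moment (bigD1 x) // [ltnRHS](bigD1 x) //= (bigD1 y) // [X in (_ < _ + X)%N](bigD1 y) //=.
rewrite tpermL tpermR.
rewrite [X in (_ < _ + (_ + X))%N](eq_bigr (fun i => w i * T i)%N); last first.
  by move=> u /andP[ux uy]; rewrite tpermD // eq_sym.
rewrite [ltnRHS]addnA [ltnLHS]addnA ltn_add2r; nia.
Qed.

(** Counting within the block of [u]: if [T (s u) < T u], then everything weakly below [u] has a
    value of [T \o s] at most [T (s u)], whereas only elements strictly below [u] can have such a
    value of [T]. But [s] matches these two level sets bijectively. *)
Lemma block_monotone_le b w T s :
    (forall u v, b u = b v -> w u = w v -> u = v) ->
    (forall u, b (s u) = b u) ->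
    block_monotone b w T -> block_monotone b w (fun u => T (s u)) ->
  forall u, (T u <= T (s u))%N.
Proof.
move=> inj hs mT mTs u; rewrite leqNgt; apply/negP=> lt.
pose A := [set v | (b v == b u) && (w v <= w u)%N].
pose B := [set v | (b v == b u) && (T (s v) <= T (s u))%N].
pose C := [set v | (b v == b u) && (T v <= T (s u))%N].
have AB : A \subset B.
  apply/subsetP=> v; rewrite !inE => /andP[/eqP bv]; rewrite bv eqxx /= leq_eqVlt.
  by case/orP=> [/eqP wv|]; [rewrite (inj v u) | apply: mTs].
have BC : #|B| = #|C|.
  rewrite -(card_imset _ (@perm_inj _ s)); apply: eq_card => v.
  rewrite -[v](permKV s) mem_imset; last exact: perm_inj.
  by rewrite !inE hs.
have CA : C \subset A :\ u.
  apply/subsetP=> v; rewrite !inE => /andP[/eqP bv hv]; rewrite bv eqxx /=.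
  have nuv : v != u by apply: contraTneq hv => ->; rewrite -ltnNge.
  rewrite nuv /= leqNgt; apply/negP=> /(mT _ _ (esym bv)) h.
  by have := leq_trans h hv; rewrite leqNgt lt.
have := leq_trans (subset_leq_card AB) (eq_leq BC).
move/leq_trans/(_ (subset_leq_card CA)).
by rewrite (cardsD1 u A) inE eqxx leqnn /= ltnn.
Qed.

Lemma block_monotone_eq b w T s :
    (forall u v, b u = b v -> w u = w v -> u = v) ->
    (forall u, b (s u) = b u) ->
    block_monotone b w T -> block_monotone b w (fun u => T (s u)) ->
  forall u, T (s u) = T u.
Proof.
move=> inj hs mT mTs u; apply/eqP; rewrite eqn_leq (block_monotone_le inj hs) // andbT.
have := @block_monotone_le b w (fun u => T (s u)) s^-1%g inj _ mTs _ u.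
rewrite permKV; apply=> [v|v v' bv wv]; first by rewrite -[in RHS](permKV s v) hs.
by rewrite !permKV; apply: mT.
Qed.

(* The moment is maximal at some rearrangement; exchanging two entries shows that
   it is monotone on blocks, so it is [T] itself. *)
Lemma moment_le b w T s :
    (forall u v, b u = b v -> w u = w v -> u = v) ->
    (forall u, b (s u) = b u) -> block_monotone b w T ->
  (moment w (fun u => T (s u)) <= moment w T
     ?= iff [forall u, T (s u) == T u])%N.
Proof.
move=> inj hs mT; pose P (s : 'S_n) := [forall u, b (s u) == b u].
have hP s' : reflect (forall u, b (s' u) = b u) (P s') by apply: (iffP forallP) => h u; apply/eqP/h.
have P1 : P 1%g by apply/hP => u; rewrite perm1.
pose f (s : 'S_n) := moment w (fun u => T (s u)).
have f1 : f 1%g = moment w T by apply: eq_bigr => u _; rewrite perm1.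
have maxE s' : P s' -> (forall s'', P s'' -> f s'' <= f s')%N -> forall u, T (s' u) = T u.
  move=> Ps' max; apply: (block_monotone_eq inj) => //; first exact/hP.
  move=> u v bu wu; rewrite leqNgt; apply/negP=> lt.
  have Pt : P (tperm u v * s')%g.
    by apply/hP=> x; rewrite permM (hP _ Ps'); case: tpermP => // ->.
  have := max _ Pt; rewrite leqNgt => /negP; apply.
  rewrite (leq_trans (moment_tperm (T := fun u => T (s' u)) wu lt)) //.
  by apply: eq_leq; apply: eq_bigr => x _; rewrite permM.
case: (arg_maxnP f P1) => s0 Ps0 max0.
have E0 : f s0 = moment w T.
  by apply: eq_bigr => u _; rewrite (maxE s0 Ps0).
have le1 s' : P s' -> (f s' <= moment w T)%N by rewrite -E0; apply: max0.
have Ps : P s by apply/hP.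
split; first exact: le1.
(* In case of equality [s] is itself a maximizer, so [maxE] applies to it. *)
apply/eqP/forallP => [E u|h].
  by apply/eqP/maxE => // s'' /le1; rewrite -E.
by apply: eq_bigr => u _; rewrite (eqP (h u)).
Qed.

End Rearrangement.

(** * Colours of labels *)

Lemma shift_tperm n k m (h : (k + m <= n)%N) (x y : 'I_m) :
  exists x' y' : 'I_n, shift h (tperm x y) = tperm x' y' /\ ((x' != y') = (x != y)).
Proof.
have lt (z : 'I_m) : (k + z < n)%N by rewrite (leq_trans _ h) // ltn_add2l.
exists (Ordinal (lt x)), (Ordinal (lt y)); split; last first.
  by congr (~~ _); rewrite -val_eqE /= eqn_add2l.
apply/permP=> u; have [[z Eu]|ou] := shift_cases k m u.
  apply: val_inj; rewrite /= (shiftE h _ Eu) !permE /= -!val_eqE /= Eu !eqn_add2l.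
  by case: ifP => // _; case: ifP.
rewrite shift_id // tpermD //; apply: contraNneq ou => <- /=;
  by rewrite leq_addr ltn_add2l ltn_ord.
Qed.

(** By induction on a factorization into transpositions, each of which shifts to a transposition. *)
Lemma psgn_shift n k m (h : (k + m <= n)%N) (s : 'S_m) : psgn (shift h s) = psgn s.
Proof.
have [ts -> hts] := prod_tpermP s.
elim: ts hts => [|[x y] ts IH] /= => [_|/andP[hxy hts]].
  rewrite big_nil; have: (shift h 1 = shift h 1 * shift h 1)%g by rewrite -shiftM mulg1.
  by rewrite -{1}[shift h 1%g]mulg1 => /mulgI <-; rewrite /psgn !odd_perm1.
rewrite big_cons shiftM !psgnM IH //; congr (_ * _).
have [x' [y' [-> e]]] := shift_tperm h x y.
by rewrite /psgn !odd_tperm e.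
Qed.

Section Colours.
Context (n : nat) (ab : bicomp n).
Local Notation a := (sumn (bca ab)).
Local Notation b := (sumn (bcb ab)).
Local Notation lc := (label_colour ab).
Implicit Types (h : 'S_n) (u v : 'I_n).

Lemma is_c_label u : is_c (lc u) = (u < a)%N.
Proof. by rewrite /label_colour; case: ifP. Qed.

(** Numbering the colours consecutively turns their order into that of [nat], so that moments of
    tableaux make sense. *)
Definition colour_key (c : colour) : nat :=
  match c with inl i => i | inr j => size (bca ab) + j end.

Definition colour_valid (c : colour) : bool :=
  match c with inl i => i < size (bca ab) | inr j => j < size (bcb ab) end%N.

Lemma label_valid u : colour_valid (lc u).
Proof.
rewrite /label_colour; case: ltnP => hu /=; first exact: reshape_indexP.
by apply: reshape_indexP; rewrite ltn_subLR // bicomp_sum.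
Qed.

Lemma colour_key_le c d : colour_valid c -> colour_valid d ->
  colour_le c d = (colour_key c <= colour_key d)%N.
Proof.
by case: c d => [i|i] [j|j] //= hi hj; rewrite ?leq_add2l //; lia.
Qed.

Lemma colour_key_inj c d : colour_valid c -> colour_valid d ->
  colour_key c = colour_key d -> c = d.
Proof. case: c d => [i|i] [j|j] /= hi hj; [by move-> | lia | lia |].
by move/addnI->. Qed.

Lemma label_shAB xa xb u : xa \in young _ (bca ab) -> xb \in young _ (bcb ab) ->
  lc (shAB ab xa xb u) = lc u.
Proof.
rewrite !inE => /forallP ha /forallP hb; rewrite permM /label_colour.
case: (ltnP u a) => hu.
  rewrite shiftB_id // shiftA_lt // (@shiftE n 0 _ (bca_leq ab) xa (Ordinal hu) u) //=.
  by rewrite add0n (eqP (ha _)).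
rewrite shiftA_id ?shiftB_ge // ltnNge shiftB_ge //=.
have hu' : (u - a < b)%N by rewrite ltn_subLR // bicomp_sum.
rewrite (@shiftE n a _ (bcb_leq ab) xb (Ordinal hu') u) /= ?subnKC // addKn.
by rewrite (eqP (hb _)).
Qed.

(** The Young subgroup is the full stabilizer of the colouring of labels: such an [h] preserves the
    labels below [a] and those from [a] on, and its two restrictions are the components. *)
Lemma label_stab h : (forall u, lc (h u) = lc u) -> exists xa xb,
  [/\ xa \in young _ (bca ab), xb \in young _ (bcb ab) & h = shAB ab xa xb].
Proof.
move=> hh; have hlt u : (h u < a)%N = (u < a)%N by rewrite -!is_c_label hh.
have la (y : 'I_a) : (y < n)%N by apply: leq_trans (ltn_ord y) (bca_leq ab).
have lb (y : 'I_b) : (a + y < n)%N by rewrite -[ltnRHS](bicomp_sum ab) ltn_add2l.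
have lha (y : 'I_a) : (h (Ordinal (la y)) < a)%N by rewrite hlt /=.
have lhb (y : 'I_b) : (h (Ordinal (lb y)) - a < b)%N.
  by rewrite ltn_subLR ?bicomp_sum // leqNgt hlt /= -leqNgt leq_addr.
have inja : injective (fun y => Ordinal (lha y)).
  move=> x y /(congr1 val) /= /val_inj /perm_inj /(congr1 val) /= E.
  exact: val_inj.
have injb : injective (fun y => Ordinal (lhb y)).
  have ge (y : 'I_b) : (a <= h (Ordinal (lb y)))%N by rewrite leqNgt hlt /= -leqNgt leq_addr.
  move=> x y /(congr1 val) /= E; apply: val_inj; apply/eqP; rewrite -(eqn_add2l a).
  apply/eqP; have/val_inj/perm_inj/(congr1 val) // : h (Ordinal (lb x)) = h (Ordinal (lb y)) :> nat.
  by rewrite -(subnKC (ge x)) E subnKC.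
exists (perm inja), (perm injb); split.
- rewrite inE; apply/forallP=> y; rewrite permE /=.
  by have := hh (Ordinal (la y)); rewrite /label_colour lha /= ltn_ord => -[->].
- rewrite inE; apply/forallP=> y; rewrite permE /=.
  have := hh (Ordinal (lb y)); rewrite /label_colour hlt /= ltnNge leq_addr /= addKn.
  by case=> ->.
apply/permP=> u; rewrite permM; apply: val_inj; rewrite /=; case: (ltnP u a) => hu.
  rewrite shiftB_id // (@shiftE n 0 _ (bca_leq ab) _ (Ordinal hu) u) // permE /= add0n.
  by congr (val (h _)); apply: val_inj.
have hu' : (u - a < b)%N by rewrite ltn_subLR // bicomp_sum.
rewrite shiftA_id ?shiftB_ge // (@shiftE n a _ (bcb_leq ab) _ (Ordinal hu') u) /= ?subnKC //.
rewrite permE /=; have -> : Ordinal (lb (Ordinal hu')) = u by apply: val_inj; rewrite /= subnKC.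
by rewrite subnKC // leqNgt hlt -leqNgt.
Qed.

Lemma shAB_fixB xa xb : (forall u, ~~ is_c (lc u) -> shAB ab xa xb u = u) -> xb = 1%g.
Proof.
move=> fx; apply: (@shiftB_inj n ab) => u hu; rewrite shiftB1 perm1.
have := fx u; rewrite is_c_label -leqNgt permM shiftA_id ?shiftB_ge //; exact.
Qed.

Lemma shAB_fixA xa xb : (forall u, is_c (lc u) -> shAB ab xa xb u = u) ->
  psgn xb = psgn (shAB ab xa xb).
Proof.
move=> fx; suff -> : xa = 1%g by rewrite /shAB shiftA1 mulg1 psgn_shift.
apply: (@shAB_injA n ab _ 1%g _ 1%g); rewrite shAB1 /shAB shiftB1 mul1g.
apply/permP=> u; rewrite perm1; case: (ltnP u a) => hu; last by rewrite shiftA_id.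
by have := fx u; rewrite is_c_label permM shiftB_id //; apply.
Qed.

End Colours.

(** * Tableaux in terms of labels *)

Lemma card_block n k (mu : seq nat) (h : (k + sumn mu <= n)%N) i : (i < size mu)%N ->
  #|[pred u : 'I_n | (k <= u < k + sumn mu)%N && (reshape_index mu (u - k) == i)]|
    = nth 0%N mu i.
Proof.
move=> hi.
have lt (j : 'I_(nth 0%N mu i)) : (k + flatten_index mu i j < n)%N.
  by rewrite (leq_trans _ h) // ltn_add2l; apply: flatten_indexP.
have inj : injective (fun j => Ordinal (lt j)).
  move=> j j' /(congr1 val) /= /addnI E; apply: val_inj.
  by rewrite /= -(flatten_indexKr (ltn_ord j)) E flatten_indexKr.
rewrite -[RHS]card_ord -(card_imset _ inj); apply: eq_card => u; rewrite inE.
apply/andP/imsetP => [[/andP[h1 h2] /eqP E]|[j _ ->]] /=.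
  have hu : (u - k < sumn mu)%N by rewrite ltn_subLR.
  have hj : (reshape_offset mu (u - k) < nth 0%N mu i)%N by rewrite -E; apply: reshape_offsetP.
  exists (Ordinal hj) => //; apply: val_inj; rewrite /= -E reshape_indexK.
  by rewrite subnKC.
by rewrite leq_addr ltn_add2l flatten_indexP // addKn flatten_indexKl.
Qed.

Section Labels.
Context (n : nat) (lam : intpart n) (ab : bicomp n) (t0 : tableau n lam).
Local Notation lc := (label_colour ab).
Implicit Types (d s : 'S_n) (u v : 'I_n).

Definition label_row u : nat := row_of (tab_inv t0 u).
Definition label_col u : nat := col_of (tab_inv t0 u).

Lemma lrow_lcol_inj u v : label_row u = label_row v -> label_col u = label_col v -> u = v.
Proof.
rewrite /label_row /label_col => hr hc; rewrite -(tab_invK t0 u) -(tab_invK t0 v); congr (val t0 _).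
move: (tab_inv t0 u) (tab_inv t0 v) hr hc => [i j] [i' j'].
rewrite /row_of /col_of /= => /val_inj Ei; case: i' / Ei j' => j' /val_inj ->.
by [].
Qed.

(** The parts decrease weakly, so the diagram is closed under moving up and to the left. *)
Lemma shape_closed u r c : (r <= label_row u)%N -> (c <= label_col u)%N ->
  exists v, label_row v = r /\ label_col v = c.
Proof.
rewrite /label_row /label_col; case: (tab_inv t0 u) => i j; rewrite /row_of /col_of /= => hr hc.
have lti : (r < size lam)%N by apply: leq_ltn_trans (ltn_ord i).
have ltj : (c < nth 0%N lam (Ordinal lti))%N.
  apply: (leq_ltn_trans hc); apply: (leq_trans (ltn_ord j)) => /=.
  have /andP[_ hs] := intpart_partition lam.
  apply: (sorted_leq_nth (leT := geq)) => //; last exact: ltn_ord.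
    by move=> x y z /= h1 h2; apply: leq_trans h1.
  by move=> x /=.
exists (val t0 (Tagged (fun i : 'I_(size lam) => 'I_(nth 0%N lam i)) (Ordinal ltj))).
by rewrite tabK.
Qed.

Lemma row_stab_lrow s : reflect (forall u, label_row (s u) = label_row u) (s \in row_stab t0).
Proof.
apply: (iffP (row_stabP _ _)) => h u; first by rewrite /label_row -[u in LHS](tab_invK t0) h.
by have := h (val t0 u); rewrite /label_row tabK.
Qed.

Lemma col_stab_lcol s : reflect (forall u, label_col (s u) = label_col u) (s \in col_stab t0).
Proof.
rewrite inE; apply: (iffP forallP) => [h u|h x].
  have : s u \in col_set t0 (tab_inv t0 u).
    rewrite -(eqP (h (tab_inv t0 u))) imset_f //; apply/imsetP.
    by exists (tab_inv t0 u); rewrite ?inE ?tab_invK.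
  by case/imsetP=> z; rewrite inE => /eqP Ez Eu; rewrite /label_col Eu tabK.
rewrite eqEcard card_imset ?leqnn ?andbT; last exact: perm_inj.
apply/subsetP=> _ /imsetP[_ /imsetP[y hy ->] ->].
apply/imsetP; exists (tab_inv t0 (s (val t0 y))); last by rewrite tab_invK.
by move: hy; rewrite !inE; have := h (val t0 y); rewrite /label_col tabK => ->.
Qed.

(** The entry of [T_ ab t0 d] at the node that [t0] labels [u]; working with labels avoids the
    dependent type of nodes. *)
Definition perm_colour d u : colour := lc (d^-1%g u).
Definition perm_key d u : nat := colour_key ab (perm_colour d u).

Lemma T_perm_colour d x : T_ ab t0 d x = perm_colour d (val t0 x).
Proof. by rewrite !ffunE tab_invK. Qed.

Lemma perm_keyM s d u : perm_key (s ∘ d) u = perm_key d (s^-1%g u).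
Proof. by rewrite /perm_key /perm_colour invMg permM. Qed.

Lemma perm_colour_shAB d xa xb u : xa \in young _ (bca ab) -> xb \in young _ (bcb ab) ->
  perm_colour (d ∘ shAB ab xa xb) u = perm_colour d u.
Proof.
by move=> ha hb; rewrite /perm_colour invMg permM shABV label_shAB ?groupV.
Qed.

Lemma perm_key_inj d d' u v : perm_key d u = perm_key d' v -> perm_colour d u = perm_colour d' v.
Proof. by apply: colour_key_inj; apply: label_valid. Qed.

Record label_sstd d : Prop := LabelSstd {
  sstd_row : block_monotone label_row label_col (perm_key d);
  sstd_col : block_monotone label_col label_row (perm_key d);
  sstd_row_c : forall u v, u != v -> label_row u = label_row v -> perm_colour d u = perm_colour d v ->
    is_c (perm_colour d u);
  sstd_col_d : forall u v, u != v -> label_col u = label_col v -> perm_colour d u = perm_colour d v ->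
    ~~ is_c (perm_colour d u) }.

Lemma semistandardP d : reflect (label_sstd d) (semistandard (T_ ab t0 d)).
Proof.
have le u v : colour_le (perm_colour d u) (perm_colour d v) = (perm_key d u <= perm_key d v)%N.
  by rewrite (@colour_key_le _ ab) ?label_valid.
have eqt u v : (tab_inv t0 u == tab_inv t0 v) = (u == v).
  by apply/eqP/eqP => [/(congr1 (val t0))|->] //; rewrite !tab_invK.
apply: (iffP and4P) => [[h1 h2 h3 h4]|[h1 h2 h3 h4]].
  split=> u v.
  - move=> hr hc; have /forallP/(_ (tab_inv t0 v)) := forallP h1 (tab_inv t0 u).
    by rewrite !T_perm_colour !tab_invK le
      -/(label_row u) -/(label_row v) hr eqxx -/(label_col u) -/(label_col v) hc.
  - move=> hr hc; have /forallP/(_ (tab_inv t0 v)) := forallP h2 (tab_inv t0 u).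
    by rewrite !T_perm_colour !tab_invK le
      -/(label_col u) -/(label_col v) hr eqxx -/(label_row u) -/(label_row v) hc.
  - move=> nuv hr E; have /forallP/(_ (tab_inv t0 v)) := forallP h3 (tab_inv t0 u).
    by rewrite !T_perm_colour !tab_invK eqt nuv -/(label_row u) -/(label_row v) hr E !eqxx.
  - move=> nuv hr E; have /forallP/(_ (tab_inv t0 v)) := forallP h4 (tab_inv t0 u).
    by rewrite !T_perm_colour !tab_invK eqt nuv -/(label_col u) -/(label_col v) hr E !eqxx.
have rE x : row_of x = label_row (val t0 x) by rewrite /label_row tabK.
have cE x : col_of x = label_col (val t0 x) by rewrite /label_col tabK.
have nE x y : (x == y) = (val t0 x == val t0 y) by rewrite (inj_eq (@tableau_inj n lam t0)).
split; apply/forallP=> x; apply/forallP=> y; apply/implyP; rewrite ?nE !T_perm_colour ?le ?rE ?cE.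
- by case/andP=> /eqP; apply: h1.
- by case/andP=> /eqP; apply: h2.
- by case/and3P=> hn /eqP hr /eqP; apply: h3 hr.
- by case/and3P=> hn /eqP hr /eqP; apply: h4 hr.
Qed.

(** The action only permutes entries, so the type is automatic and [sstd] reduces to
    [semistandard]. *)
Lemma T_of_type d : of_type ab (T_ ab t0 d).
Proof.
have cnt c : #|[pred x | T_ ab t0 d x == c]| = #|[pred u : 'I_n | lc u == c]|.
  have inj : injective (fun x => d^-1%g (val t0 x)) by move=> x y /perm_inj/tableau_inj.
  rewrite -(card_image inj); apply: eq_card => u; rewrite !inE.
  apply/imageP/eqP => [[x]|E]; first by rewrite inE T_perm_colour => /eqP <- ->.
  by exists (tab_inv t0 (d u)); rewrite ?inE ?T_perm_colour /perm_colour tab_invK permK ?E.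
apply/and3P; split; apply/forallP=> i.
- by rewrite T_perm_colour; have := @label_valid n ab (d^-1%g (val t0 i)); rewrite /perm_colour.
- rewrite cnt -(card_block (bca_leq ab) (ltn_ord i)); apply/eqP; apply: eq_card => u.
  rewrite !inE /label_colour add0n subn0 /=; case: ltnP => //= _.
- rewrite cnt -(card_block (bcb_leq ab) (ltn_ord i)); apply/eqP; apply: eq_card => u.
  rewrite !inE /label_colour bicomp_sum ltn_ord andbT ltnNge; case: leqP => //= _.
Qed.

Lemma sstd_T d : sstd ab (T_ ab t0 d) <-> label_sstd d.
Proof. by rewrite /sstd T_of_type /=; split=> /semistandardP. Qed.

End Labels.

(** * Garnir relations and coordinates of homomorphisms *)

Section Garnir.
Context (n : nat) (lam : intpart n) (t0 : tableau n lam).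
Local Notation C0 := (col_stab t0).
Local Notation lrow := (label_row t0).
Local Notation w := (tab_quot t0 (row_reading lam)).
Local Notation coset y := (pm_basis lam (left_coset y (young n lam))).
Implicit Types (s u : 'S_n) (Z : {set 'I_n}).

(** The combinatorial condition under which the signed sum over the permutations of [Z] annihilates
    the polytabloid of [t0]. *)
Definition row_clash Z := forall s, s \in C0 ->
  exists z z', [/\ z \in Z, z' \in Z, z != z' & lrow (s z) = lrow (s z')].

Lemma polytabloid_move s :
  polytabloid (tab_move s t0) = \sum_(u in C0) coset (s ∘ u ∘ w) *~ psgn u.
Proof.
rewrite -pm_act_polytabloid /polytabloid raddf_sum /=; apply: eq_bigr => u _.
by rewrite pm_actMz pm_act_basis mulgA.
Qed.

Lemma polytabloid_anti s : s \in C0 -> polytabloid (tab_move s t0) = polytabloid t0 *~ psgn s.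
Proof.
move=> hs; rewrite polytabloid_move /polytabloid mulrz_suml.
rewrite [RHS](reindex_inj (mulIg s)) /=; apply: eq_big => [u|u _].
  by rewrite groupMr.
by rewrite psgnM -mulrzA -mulrA psgn2 mulr1 .
Qed.

(** Conjugation by [w] carries the Young subgroup of [lam] to the row stabilizer of [t0], so the
    coset absorbs [u]. *)
Lemma coset_row_stab u x : u \in row_stab t0 -> coset (x ∘ u ∘ w) = coset (x ∘ w).
Proof.
move=> hu; have hy : (u ^ w^-1)%g \in young n lam.
  by rewrite -row_stab_reading -(row_stab_move w) tab_moveK conjgKV.
congr (pm_basis _ _); rewrite !left_cosetE.
have -> : (x ∘ u ∘ w = (u ^ w^-1) * (x ∘ w))%g.
  by rewrite conjgE invgK !mulgA mulgKV.
by rewrite rcosetM rcoset_id.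
Qed.

(** Precomposing with the transposition reverses every sign, so the sum is its own negative; the
    last hypothesis excludes 2-torsion. *)
Lemma sum_perm_on_tperm (V : zmodType) (f : 'S_n -> V) Z z z' :
    z \in Z -> z' \in Z -> z != z' ->
    (forall s, f (tperm z z' * s)%g = f s) ->
  (forall v : V, v + v = 0 -> v = 0) ->
  \sum_(s | perm_on Z s) f s *~ psgn s = 0.
Proof.
move=> hz hz' nz hf V2; apply: V2.
rewrite [X in X + _](reindex_inj (mulgI (tperm z z'))) /=.
have hp : perm_on Z (tperm z z').
  by apply/subsetP=> v; rewrite inE; case: tpermP => [->|->|]; rewrite ?eqxx.
rewrite [X in X + _](eq_big (perm_on Z) (fun s => - (f s *~ psgn s))) => [|s|s _].
- by rewrite sumrN addNr.
- apply/idP/idP=> [h|]; last exact: perm_onM.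
  by rewrite -[s](mulKg (tperm z z')) tpermV perm_onM.
by rewrite hf psgnM {1}/psgn odd_tperm nz mulN1r mulrNz.
Qed.

(* For each column permutation [u] two labels of [Z] clash in a row, and exchanging them
   fixes the coset of [u ∘ w] while changing signs. *)
Lemma polytabloid_garnir Z : row_clash Z ->
  \sum_(s | perm_on Z s) polytabloid (tab_move s t0) *~ psgn s = 0.
Proof.
move=> hZ.
under eq_bigr => s _ do rewrite polytabloid_move mulrz_suml.
rewrite exchange_big /= big1 // => u hu.
rewrite (eq_bigr (fun s => coset (s ∘ u ∘ w) *~ psgn s *~ psgn u)); last first.
  by move=> s _; rewrite -!mulrzA mulrC.
(* The clash is taken for the inverse of [u]: then the transposition of [z] and [z'], moved past
   [u], exchanges two labels in one row of [t0]. *)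
rewrite -mulrz_suml; have [z [z' [hz hz' nz hr]]] := hZ _ (groupVr hu).
rewrite (sum_perm_on_tperm hz hz' nz) ?mul0rz // => [s|f hf].
  have -> : (tperm z z' * s)%g ∘ u ∘ w = s ∘ u ∘ tperm (u^-1%g z) (u^-1%g z') ∘ w.
    by rewrite -tpermJ conjgE invgK !mulgA mulgKV.
  rewrite coset_row_stab //; apply/row_stab_lrow=> v.
  by case: tpermP => // ->.
apply/ffunP=> X; move/ffunP/(_ X): hf; rewrite !ffunE => /eqP.
by rewrite -mulr2n mulrn_eq0 => /eqP.
Qed.

End Garnir.

(** * Coordinates in the induced module *)

Section Coordinates.
Context (n : nat) (lam : intpart n) (ab : bicomp n) (t0 : tableau n lam).
Context (Gamma : {set 'S_n}) (HG : left_transversal (youngAB ab) Gamma).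
Local Notation M := (ind_mod ab Gamma).
Local Notation G := {d | d \in Gamma}.
Implicit Types (m : M) (x s : 'S_n).

(* The coefficient of [m] at x ⊗ 1 ⊗ ϵ for arbitrary [x]. *)
Definition coef_at m x : int := \sum_(g : G) m g * ind_vec ab Gamma x g.

Lemma coef_at_basis m (g : G) : coef_at m (val g) = m g.
Proof.
rewrite /coef_at (bigD1 g) //= big1 ?ind_vec_basis ?eqxx ?mulr1 ?addr0 // => g' /negPf ne.
by rewrite ind_vec_basis // ne mulr0.
Qed.

Lemma coef_atM m x xa xb : xa \in young _ (bca ab) -> xb \in young _ (bcb ab) ->
  coef_at m (x ∘ shAB ab xa xb) = psgn xb * coef_at m x.
Proof.
move=> ha hb; rewrite /coef_at mulr_sumr; apply: eq_bigr => g _.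
by rewrite /shAB -mulgA ind_vecM // ffun_mulrzE mulrA mulrC.
Qed.

Lemma coef_at_act m s x : coef_at (ind_act s m) x = coef_at m (s^-1%g ∘ x).
Proof.
have [g [xa [xb [ha hb ->]]]] := transversal_ex HG x.
rewrite coef_atM // -mulgA coef_atM // coef_at_basis; congr (_ * _).
have {1}-> : m = [ffun g' : G => coef_at m (val g')] by apply/ffunP=> g'; rewrite ffunE coef_at_basis.
by rewrite ind_act_coord // => y ya yb hya hyb; rewrite coef_atM.
Qed.

Lemma coef_at0 x : coef_at 0 x = 0.
Proof. by rewrite /coef_at big1 // => g _; rewrite ffunE mul0r. Qed.

Lemma coef_atMz m k x : coef_at (m *~ k) x = k * coef_at m x.
Proof.
rewrite /coef_at mulr_sumr; apply: eq_bigr => g _.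
by rewrite ffun_mulrzE mulrA [k * _]mulrC.
Qed.

Lemma coef_at_sum (I : finType) (P : pred I) (F : I -> M) (k : I -> int) x :
  coef_at (\sum_(i | P i) F i *~ k i) x = \sum_(i | P i) k i * coef_at (F i) x.
Proof.
rewrite /coef_at; under eq_bigr => g _ do rewrite sum_ffunE mulr_suml.
rewrite exchange_big /=; apply: eq_bigr => i _; rewrite mulr_sumr; apply: eq_bigr => g _.
by rewrite ffun_mulrzE mulrA [k i * _]mulrC.
Qed.

Lemma coef_at_sum_vec (k : 'S_n -> int) (g0 : G) :
  coef_at (\sum_(g : G) ind_vec ab Gamma (val g) *~ k (val g)) (val g0) = k (val g0).
Proof.
rewrite coef_at_sum (bigD1 g0) //= big1 ?coef_at_basis ?ind_vec_basis ?eqxx ?mulr1 ?addr0 // => g /negPf ne.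
by rewrite coef_at_basis // ind_vec_basis // eq_sym ne mulr0.
Qed.

(* [F] stands for the coefficients of the image of [specht_e t0] under a homomorphism. *)
Record specht_fun (F : 'S_n -> rat) : Prop := SpechtFun {
  sfM : forall x xa xb, xa \in young _ (bca ab) -> xb \in young _ (bcb ab) ->
    F (x ∘ shAB ab xa xb) = (psgn xb)%:~R * F x;
  sf_anti : forall s x, s \in col_stab t0 -> F (s ∘ x) = (psgn s)%:~R * F x;
  sf_garnir : forall Z x, row_clash t0 Z ->
    \sum_(s | perm_on Z s) (psgn s)%:~R * F (s ∘ x) = 0 }.

(** The three conditions are linear. Rational values allow a rational combination of homomorphisms
    to be subtracted from a given one. *)
Lemma specht_fun_lin (I : finType) (P : pred I) (F0 : 'S_n -> rat) (F : I -> 'S_n -> rat)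
    (c : I -> rat) : specht_fun F0 -> (forall i, P i -> specht_fun (F i)) ->
  specht_fun (fun x => F0 x - \sum_(i | P i) c i * F i x).
Proof.
move=> h0 hF; split=> [x xa xb ha hb|s x hs|Z x hZ].
- rewrite (sfM h0) // mulrBr mulr_sumr; congr (_ - _); apply: eq_bigr => i Pi.
  by rewrite (sfM (hF i Pi)) // mulrCA.
- rewrite (sf_anti h0) // mulrBr mulr_sumr; congr (_ - _); apply: eq_bigr => i Pi.
  by rewrite (sf_anti (hF i Pi)) // mulrCA.
under eq_bigr => s _ do rewrite mulrBr mulr_sumr.
rewrite sumrB (sf_garnir h0) // sub0r exchange_big /= big1 ?oppr0 // => i Pi.
under eq_bigr => s _ do rewrite mulrCA.
by rewrite -mulr_sumr (sf_garnir (hF i Pi)) // mulr0.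
Qed.

Lemma perm_on_inv Z s : perm_on Z s^-1%g = perm_on Z s.
Proof.
have imp u : perm_on Z u -> perm_on Z u^-1%g.
  move=> /subsetP h; apply/subsetP=> v; rewrite inE => ne; apply: h; rewrite inE.
  by apply: contra ne => /eqP E; rewrite -{1}E permK.
by apply/idP/idP=> /imp; rewrite ?invgK.
Qed.

(** Translating the argument by [s] amounts to moving the tableau by the inverse of [s], so
    relations among polytabloids become relations among coefficients. *)
Lemma specht_fun_hom (f : {additive specht lam -> M}) : is_hom f ->
  specht_fun (fun x => (coef_at (f (specht_e t0)) x)%:~R).
Proof.
move=> hf.
have fE s x :
    coef_at (f (specht_e t0)) (s ∘ x) = coef_at (f (specht_e (tab_move s^-1%g t0))) x.
  by rewrite -specht_act_e hf coef_at_act invgK.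
split=> [x xa xb ha hb|s x hs|Z x hZ].
- by rewrite coef_atM // intrM.
- rewrite fE -intrM; have -> : specht_e (tab_move s^-1%g t0) = specht_e t0 *~ psgn s.
    apply: val_inj; rewrite /= polytabloid_anti ?groupV // psgnV.
    by rewrite -[RHS]/(val (specht_e t0 *~ psgn s)) raddfMz.
  by rewrite raddfMz coef_atMz.
rewrite (reindex_inj invg_inj) /=.
under eq_bigl => s do rewrite perm_on_inv.
under eq_bigr => s _ do rewrite -intrM fE invgK psgnV.
rewrite -rmorph_sum -coef_at_sum /=.
under eq_bigr => s _ do rewrite -raddfMz.
rewrite -raddf_sum (_ : \sum_(i | _) _ = 0) ?raddf0 ?coef_at0 //.
apply: val_inj; rewrite raddf_sum /= -[RHS](polytabloid_garnir hZ).
apply: eq_bigr => s _.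
by rewrite -[LHS]/(val (specht_e (tab_move s t0) *~ psgn s)) raddfMz.
Qed.

End Coordinates.

(** * Vanishing on semistandard tableaux *)

Section Straightening.
Context (n : nat) (lam : intpart n) (ab : bicomp n) (t0 : tableau n lam).
Local Notation C0 := (col_stab t0).
Local Notation lrow := (label_row t0).
Local Notation lcol := (label_col t0).
Local Notation pcol := (perm_colour ab).
Local Notation pkey := (perm_key ab).
Implicit Types (d s p : 'S_n) (u v x y : 'I_n).

(** A permutation preserving the entries of T_d passes through [d] into the Young subgroup. The last
    two clauses give the sign it contributes when it moves only labels of c-colours or only labels
    of d-colours. *)
Lemma perm_colour_stab d p : (forall u, pcol d (p u) = pcol d u) -> exists xa xb,
  [/\ xa \in young _ (bca ab), xb \in young _ (bcb ab), p ∘ d = d ∘ shAB ab xa xb,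
      (forall u, ~~ is_c (pcol d u) -> p u = u) -> xb = 1%g
    & (forall u, is_c (pcol d u) -> p u = u) -> psgn xb = psgn p].
Proof.
move=> hp; have [u|xa [xb [ha hb E]]] := @label_stab n ab (p ^ d^-1)%g.
  by rewrite conjgE !permM invgK; have := hp (d u); rewrite /perm_colour permK.
exists xa, xb; split=> //; first by rewrite -E conjgE invgK mulgA mulgKV.
- move=> fx; apply: (@shAB_fixB n ab xa) => u hu; rewrite -E conjgE !permM invgK fx ?permK //.
  by rewrite /perm_colour permK.
- move=> fx; rewrite (@shAB_fixA n ab xa) -?E ?psgnJ // => u hu.
  by rewrite conjgE !permM invgK fx ?permK // /perm_colour permK.
Qed.

Lemma tperm_perm_colour d x y : pcol d x = pcol d y -> forall u, pcol d (tperm x y u) = pcol d u.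
Proof. by move=> E u; case: tpermP => // ->. Qed.

(** The two legs of a Garnir belt; the two columns need not be adjacent. *)
Definition garnir_left x0 := [set u | (lcol u == lcol x0) && (lrow x0 <= lrow u)%N].
Definition garnir_right y0 := [set u | (lcol u == lcol y0) && (lrow u <= lrow y0)%N].
Definition garnir_set x0 y0 := garnir_left x0 :|: garnir_right y0.

(** Pigeonhole: the belt has more labels than the column of [x0], yet a column permutation keeps it
    in rows that all meet this column. *)
Lemma row_clash_garnir x0 y0 : lrow x0 = lrow y0 -> (lcol x0 < lcol y0)%N ->
  row_clash t0 (garnir_set x0 y0).
Proof.
move=> hr hc s /col_stab_lcol hs.
pose frow u : 'I_(size lam) := tag (tab_inv t0 u).
have frowE u v : frow u = frow v -> lrow u = lrow v by rewrite /label_row /row_of -/(frow _) => ->.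
have frowI u v : lrow u = lrow v -> frow u = frow v by move=> E; apply: val_inj.
set X := garnir_left x0; set Y := garnir_right y0; set Z := garnir_set x0 y0.
have [/existsP[z /existsP[z' /and4P[hz hz' nz /eqP E]]]|none] := boolP [exists z, exists z',
    [&& z \in Z, z' \in Z, z != z' & lrow (s z) == lrow (s z')]].
  by exists z, z'.
pose D := [set u | lcol u == lcol x0].
have le1 : (#|Z| <= #|D|)%N.
  have inj : {in Z &, injective (fun z => frow (s z))}.
    move=> z z' hz hz' /frowE E; apply/eqP; apply: contraR none => nz.
    by apply/existsP; exists z; apply/existsP; exists z'; rewrite hz hz' nz E eqxx.
  rewrite -(card_in_imset inj); apply: leq_trans (leq_imset_card frow D).
  apply: subset_leq_card; apply/subsetP=> _ /imsetP[z hz ->].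
  have [|v [rv cv]] := @shape_closed n lam t0 (s z) (lrow (s z)) (lcol x0) (leqnn _).
    by move: hz; rewrite hs !inE => /orP[] /andP[/eqP -> _] //; apply: ltnW.
  by apply/imsetP; exists v; rewrite ?inE ?cv //; apply: frowI.
(* Each row above that of [x0] meets the column of [y0] strictly above [y0]. *)
have le2 : (#|D :\: X| <= #|Y :\ y0|)%N.
  have inj : {in D :\: X &, injective frow}.
    move=> u v; rewrite !inE => /andP[_ /eqP cu] /andP[_ /eqP cv] /frowE ruv.
    by apply: (@lrow_lcol_inj _ _ t0); rewrite // cu.
  rewrite -(card_in_imset inj); apply: leq_trans (leq_imset_card frow _).
  apply: subset_leq_card; apply/subsetP=> _ /imsetP[v hv ->].
  move: hv; rewrite !inE => /andP[+ cv]; rewrite cv /= -ltnNge hr => rv.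
  have [y [ry cy]] := shape_closed (ltnW rv) (leqnn (lcol y0)).
  apply/imsetP; exists y; last exact: frowI.
  rewrite !inE cy eqxx ry (ltnW rv) !andbT; apply: contraTneq rv => Ey.
  by rewrite -ry Ey ltnn.
have XY : [disjoint X & Y].
  rewrite -setI_eq0; apply/eqP/setP=> u; rewrite !inE; apply/negP.
  by case/andP=> /andP[/eqP -> _] /andP[/eqP E _]; rewrite E ltnn in hc.
have y0Y : y0 \in Y by rewrite inE eqxx leqnn.
have := le1; rewrite cardsU disjoint_setI0 // cards0 subn0 (cardsD1 y0 Y) y0Y.
rewrite -(cardsID X D) (_ : D :&: X = X) ?leq_add2l; last first.
  by apply/setIidPr/subsetP=> u; rewrite !inE => /andP[].
by rewrite add1n => /leq_trans/(_ le2); rewrite ltnn.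
Qed.

Section Function.
Context (F : 'S_n -> rat) (hF : specht_fun ab t0 F).

Lemma sf_swap_c d x y : pcol d x = pcol d y -> is_c (pcol d x) -> F (tperm x y ∘ d) = F d.
Proof.
move=> E hc; have [xa [xb [ha hb -> h1 _]]] := perm_colour_stab (tperm_perm_colour E).
rewrite (sfM hF) // h1 /psgn ?odd_perm1 ?mul1r // => u; case: tpermP => // ->.
  by rewrite hc.
by rewrite -E hc.
Qed.

Lemma sf_swap_d d x y : x != y -> pcol d x = pcol d y -> ~~ is_c (pcol d x) ->
  F (tperm x y ∘ d) = - F d.
Proof.
move=> nxy E hc; have [xa [xb [ha hb -> _ h2]]] := perm_colour_stab (tperm_perm_colour E).
rewrite (sfM hF) // h2 /psgn ?odd_tperm ?nxy ?mulN1r //.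
move=> u; case: tpermP => // ->; last by rewrite -E (negPf hc).
by rewrite (negPf hc).
Qed.

(* If [s] leaves the column multisets of colours unchanged because every label changing
   column carries one fixed colour of type d, exchange such labels until [s] preserves columns. *)
Lemma sf_crossing d c s : ~~ is_c c -> (forall u, lcol (s u) != lcol u -> pcol d u = c) ->
  F (s ∘ d) = (psgn s)%:~R * F d.
Proof.
move=> hc; have [m] := ubnP #|[pred u | lcol (s u) != lcol u]|.
elim: m s => // m IH s hm hs.
have [sC|] := boolP [forall u, lcol (s u) == lcol u].
  by apply: (sf_anti hF); apply/col_stab_lcol => u; apply/eqP/(forallP sC).
rewrite negb_forall => /existsP[u hu].
(* As [u] leaves its column, some label from another column must enter it. Precomposing [s] with the
   exchange of the two keeps [u] in its column and makes no further label cross. *)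
have /existsP[v /andP[/eqP hv1 hv2]] : [exists v, (lcol (s v) == lcol u) && (lcol v != lcol u)].
  apply: contraNT hu; rewrite negb_exists => /forallP h.
  pose A := [set v | lcol (s v) == lcol u]; pose B := [set v | lcol v == lcol u].
  have AB : A \subset B by apply/subsetP=> v; rewrite !inE => E; have := h v; rewrite E negbK.
  have EA : A = B.
    apply/eqP; rewrite eqEcard AB -(card_imset A (@perm_inj _ s)) subset_leq_card //.
    by apply/subsetP=> v; rewrite -[v](permKV s) mem_imset ?inE //; apply: perm_inj.
  have : u \in B by rewrite inE.
  by rewrite -EA inE.
have nuv : u != v by apply: contraNneq hv2 => ->.
have hv : lcol (s v) != lcol v by rewrite hv1 eq_sym.
have Epc : pcol d u = pcol d v by rewrite !hs.
have Ex : (s ∘ tperm u v) ∘ d = tperm (s u) (s v) ∘ (s ∘ d).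
  by rewrite -tpermJ conjgE !mulgA mulgK.
have pE x : pcol (s ∘ d) (s x) = pcol d x by rewrite /perm_colour invMg permM permK.
have tE x : lcol ((s ∘ tperm u v) x) != lcol x -> (lcol (s x) != lcol x) && (x != u).
  rewrite permM; case: tpermP => [->|->|/eqP xu _ h]; first by rewrite hv1 eqxx.
    by move=> _; rewrite hv eq_sym.
  by rewrite h.
have := IH (s ∘ tperm u v); rewrite Ex sf_swap_d ?pE ?(inj_eq perm_inj) ?hs // => IH'.
apply: oppr_inj; rewrite IH'.
- by rewrite psgnM {1}/psgn odd_tperm nuv mulN1r rmorphN mulNr.
- rewrite -ltnS (leq_trans _ hm) // ltnS; apply: proper_card; apply/properP; split.
    by apply/subsetP=> x; rewrite !inE => /tE/andP[].
  by exists u; rewrite !inE // permM tpermL hv1 eqxx.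
- by move=> x /tE/andP[/hs].
Qed.

(** Exchanging an inverted pair in a column changes [F] only by a sign and keeps the column moment,
    but raises the row moment. *)
Lemma column_max_monotone d : F d != 0 ->
    (forall s, F s != 0 -> moment lcol (pkey s) = moment lcol (pkey d) ->
       (moment lrow (pkey s) <= moment lrow (pkey d))%N) ->
  block_monotone lcol lrow (pkey d).
Proof.
move=> Fd max2 u v hc hr; rewrite leqNgt; apply/negP=> lt.
have tc x : lcol (tperm u v x) = lcol x by case: tpermP => // ->.
have Fs : F (tperm u v ∘ d) != 0.
  by rewrite (sf_anti hF) ?mulf_neq0 ?intr_eq0 /psgn ?signr_eq0 //; apply/col_stab_lcol.
have kE w : moment w (pkey (tperm u v ∘ d)) = moment w (fun x => pkey d (tperm u v x)).
  by apply: eq_bigr => x _; rewrite perm_keyM tpermV.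
have Ec : moment lcol (pkey (tperm u v ∘ d)) = moment lcol (pkey d).
  by rewrite kE moment_perm tpermV; apply: eq_bigr => x _; rewrite tc.
by have := max2 _ Fs Ec; rewrite kE leqNgt moment_tperm.
Qed.

(** By maximality of the column moment, a term of the Garnir relation survives only if every label
    that changes column has the same colour as [x0] and [y0]. Unless that colour is a c-colour, all
    surviving terms equal [F d], so they cannot cancel. *)
Lemma row_max_weak d x0 y0 : F d != 0 -> block_monotone lcol lrow (pkey d) ->
    (forall s, F s != 0 -> (moment lcol (pkey s) <= moment lcol (pkey d))%N) ->
    lrow x0 = lrow y0 -> (lcol x0 < lcol y0)%N -> (pkey d y0 <= pkey d x0)%N ->
  (pcol d x0 = pcol d y0) /\ is_c (pcol d x0).
Proof.
move=> Fd mono max hr hc hk.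
set Z := garnir_set x0 y0.
have cross s : perm_on Z s -> F (s ∘ d) != 0 -> forall k, (pkey d y0 <= k <= pkey d x0)%N ->
  forall u, lcol (s u) != lcol u -> pkey d u = k.
  move=> sZ Fs k /andP[hky hkx].
  have Xk u : u \in garnir_left x0 -> (k <= pkey d u)%N.
    rewrite inE leq_eqVlt => /andP[/eqP cu /orP[/eqP ru|]].
      by rewrite -(@lrow_lcol_inj _ _ t0 x0 u) //.
    by move/(mono _ _ (esym cu)); apply: leq_trans.
  have Yk u : u \in garnir_right y0 -> (pkey d u <= k)%N.
    rewrite inE leq_eqVlt => /andP[/eqP cu /orP[/eqP ru|]].
      by rewrite (@lrow_lcol_inj _ _ t0 u y0).
    by move/(mono _ _ cu)/leq_trans; apply.
  (* The contribution of [u] to the change of the column moment, with keys measured from [k]; this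
     shift does not affect the total because [s] permutes the labels. The left leg has keys at least
     [k] and can only move right, the right leg has keys at most [k] and can only move left, so no
     contribution is negative. *)
  pose D u : int := ((lcol (s u))%:Z - (lcol u)%:Z) * ((pkey d u)%:Z - k%:Z).
  have D0 u : true -> 0 <= D u.
    move=> _; have [uZ|/(out_perm sZ) su] := boolP (u \in Z); last first.
      by rewrite /D su subrr mul0r.
    have : s u \in Z by rewrite perm_closed.
    rewrite in_setU => /orP sZu; rewrite /D; move: uZ; rewrite in_setU => /orP[uX|uY].
      have hku := Xk _ uX; apply: mulr_ge0; last by lia.
      by move: uX sZu; rewrite !inE => /andP[/eqP -> _] [] /andP[/eqP -> _]; lia.
    have hku := Yk _ uY; apply: mulr_le0; last by lia.
    by move: uY sZu; rewrite !inE => /andP[/eqP -> _] [] /andP[/eqP -> _]; lia.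
  have sumD : \sum_u D u = 0.
    apply/eqP; rewrite eq_le sumr_ge0 // andbT.
    have hm := max _ Fs.
    have mE : moment lcol (pkey (s ∘ d)) = moment (fun u => lcol (s u)) (pkey d).
      rewrite -[s in RHS]invgK -moment_perm.
      by apply: eq_bigr => u _; rewrite perm_keyM.
    have -> : \sum_u D u = (moment (fun u => lcol (s u)) (pkey d))%:Z - (moment lcol (pkey d))%:Z
        - k%:Z * (\sum_u (lcol (s u))%:Z - \sum_u (lcol u)%:Z).
      rewrite /moment !(big_morph Posz PoszD (erefl 0%:Z)) -!sumrB mulr_sumr -sumrB.
      by apply: eq_bigr => u _; rewrite /D !PoszM; ring.
    rewrite [\sum_u (lcol (s u))%:Z](reindex_inj (@perm_inj _ s^-1%g)) /=.
    under [\sum_u (lcol (s _))%:Z]eq_bigr => u _ do rewrite permKV.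
    by rewrite subrr mulr0 subr0 -mE; lia.
  move=> u hu; have /eqP := psumr_eq0P D0 sumD (i := u) isT.
  by rewrite mulf_eq0 !subr_eq0 !eqz_nat (negPf hu) => /eqP.
have gar := sf_garnir hF d (row_clash_garnir hr hc).
have strong s : perm_on Z s -> F (s ∘ d) != 0 -> forall u, lcol (s u) != lcol u ->
    pcol d u = pcol d x0 /\ pcol d x0 = pcol d y0.
  (* Both endpoints serve as [k], so one crossing label already forces the keys of [x0] and [y0] to
     agree. *)
  move=> sZ Fs u hu; have E1 := cross s sZ Fs (pkey d x0) _ u hu.
  have E2 := cross s sZ Fs (pkey d y0) _ u hu.
  have {}E1 := E1 (introT andP (conj hk (leqnn _))).
  have {}E2 := E2 (introT andP (conj (leqnn _) hk)).
  split; apply: perm_key_inj => //; by rewrite -E1 E2.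
have [/andP[/eqP Exy c_x]|bad] := boolP ((pcol d x0 == pcol d y0) && is_c (pcol d x0)).
  by split.
have term s : perm_on Z s -> (psgn s)%:~R * F (s ∘ d) = F d *+ (F (s ∘ d) != 0).
  move=> sZ; case: eqP => [->|/eqP Fs]; first by rewrite mulr0.
  have [cc|cc] := boolP (is_c (pcol d x0)).
    have sC : s \in C0.
      apply/col_stab_lcol => u; apply/eqP; apply/negPn/negP => /(strong s sZ Fs)[_ E].
      by move: bad; rewrite E eqxx -E cc.
    by rewrite (sf_anti hF) // mulrA -intrM psgn2 mul1r.
  rewrite (sf_crossing (d := d) (s := s) cc) ?mulrA -?intrM ?psgn2 ?mul1r //.
  by move=> u /(strong s sZ Fs)[].
(* The relation now says that [F d] times the number of surviving terms is zero, and the identity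
   survives. *)
move: gar; rewrite (eq_bigr _ term) sumrMnr => /eqP; rewrite mulrn_eq0 (negPf Fd) orbF.
by rewrite (bigD1 1%g) ?perm_on1 //= mulg1 Fd.
Qed.

Lemma sf_max_sstd d : F d != 0 ->
    (forall s, F s != 0 -> (moment lcol (pkey s) <= moment lcol (pkey d))%N) ->
    (forall s, F s != 0 -> moment lcol (pkey s) = moment lcol (pkey d) ->
       (moment lrow (pkey s) <= moment lrow (pkey d))%N) ->
  label_sstd ab t0 d.
Proof.
move=> Fd max1 max2; have mono := column_max_monotone Fd max2.
split=> // u v.
- move=> hr hc; rewrite leqNgt; apply/negP=> lt.
  have [E _] := row_max_weak Fd mono max1 hr hc (ltnW lt).
  by move: lt; rewrite /perm_key E ltnn.
- have [|lt|] := ltngtP (lcol v) (lcol u).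
  + move=> lt _ hr E; have [] := row_max_weak (d := d) (x0 := v) (y0 := u) Fd mono max1 _ lt.
      by [].
      by rewrite /perm_key E.
    by rewrite E.
  + move=> _ hr E; have [] := row_max_weak (d := d) (x0 := u) (y0 := v) Fd mono max1 hr lt => //.
    by rewrite /perm_key E.
  + by move=> hc nuv hr; case/eqP: nuv; apply: (@lrow_lcol_inj _ _ t0).
(* Exchanging two equal c-colours in a column both fixes [F d] and negates it. *)
- move=> nuv hc E; apply/negP=> cu.
  have := sf_swap_c E cu; rewrite (sf_anti hF); last first.
    by apply/col_stab_lcol => x; case: tpermP => // ->.
  rewrite /psgn odd_tperm nuv mulN1r => /eqP.
  by rewrite eq_sym -addr_eq0 -mulr2n mulrn_eq0 (negPf Fd).
Qed.

Lemma sf_eq0 : (forall d, label_sstd ab t0 d -> F d = 0) -> forall d, F d = 0.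
Proof.
move=> F0 d0; apply/eqP; apply: contraT => Fd0.
have [d1 Fd1 max1] := arg_maxnP (P := fun d => F d != 0) (fun d => moment lcol (pkey d)) Fd0.
pose P d := (F d != 0) && (moment lcol (pkey d) == moment lcol (pkey d1)).
have P1 : P d1 by rewrite /P Fd1 eqxx.
have [d /andP[Fd /eqP Ed] max2] := arg_maxnP (fun d => moment lrow (pkey d)) P1.
case/eqP: (Fd); apply: F0; apply: sf_max_sstd => // s Fs; rewrite Ed; first exact: max1.
by move=> Es; apply: max2; rewrite /P Fs Es eqxx.
Qed.

End Function.
End Straightening.

(** * Triangularity *)

Section Triangular.
Context (n : nat) (lam : intpart n) (ab : bicomp n) (t0 : tableau n lam).
Context (Gamma : {set 'S_n}) (HG : left_transversal (youngAB ab) Gamma).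
Local Notation C0 := (col_stab t0).
Local Notation lrow := (label_row t0).
Local Notation lcol := (label_col t0).
Local Notation pcol := (perm_colour ab).
Local Notation pkey := (perm_key ab).
Local Notation eps := (epsilon ab t0).
Local Notation Gs := (Gamma_sstd ab t0 Gamma).
Local Notation mu d := (moment lrow (pkey d)).
Implicit Types (d s : 'S_n).

Lemma Gamma_sstdP d : d \in Gs -> d \in Gamma /\ label_sstd ab t0 d.
Proof. by rewrite inE => /andP[-> /sstd_T]. Qed.

Lemma transversal_perm_colour d d' : d \in Gamma -> d' \in Gamma ->
  (forall u, pcol d u = pcol d' u) -> d = d'.
Proof.
move=> hd hd' E; have [u|xa [xb [ha hb Eh]]] := @label_stab n ab (d' * d^-1)%g.
  by have := E (d' u); rewrite permM /perm_colour permK.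
pose g : {d | d \in Gamma} := Sub d hd; pose g' : {d | d \in Gamma} := Sub d' hd'.
have /(congr1 val) // : g = g'.
apply: (transversal_uniq HG (mem_shAB ha hb) (group1 _)).
by rewrite -Eh /= mulgKV mul1g.
Qed.

(** A column rearrangement of T_d' coincides with a row rearrangement of T_d. The latter has the row
    moment of T_d, the former at most that of T_d'. *)
Lemma eps_moment d d' s : d \in Gs -> d' \in Gs -> s \in C0 -> eps d (s ∘ d') != 0 ->
  (mu d <= mu d')%N /\
  (mu d = mu d' -> d = d' /\ forall u, pkey d (s u) = pkey d u).
Proof.
move=> /Gamma_sstdP[hd sd] /Gamma_sstdP[hd' sd'] hs.
case/epsilon0 => r [xa [xb [hr ha hb E]]].
have kE u : pkey d' (s^-1%g u) = pkey d (r^-1%g u).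
  by rewrite -!perm_keyM E /perm_key perm_colour_shAB.
have {}hs : forall u, lcol (s^-1%g u) = lcol u by apply/col_stab_lcol; rewrite groupV.
have {}hr : forall u, lrow (r^-1%g u) = lrow u by apply/row_stab_lrow; rewrite groupV.
have injc u v : lcol u = lcol v -> lrow u = lrow v -> u = v.
  by move=> ? ?; apply: (@lrow_lcol_inj _ _ t0).
have -> : mu d = moment lrow (fun u => pkey d' (s^-1%g u)).
  have -> : mu d = moment lrow (fun u => pkey d (r^-1%g u)).
    by rewrite moment_perm invgK; apply: eq_bigr => u _; rewrite -[in RHS]hr permK.
  by apply: eq_bigr => u _; rewrite kE.
have [le eq] := moment_le injc hs (sstd_col sd'); split=> // /eqP; rewrite eq => /forallP Es.
(* In case of equality [s] fixes T_d', so the row rearrangement of T_d is sorted along rows and must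
   be T_d itself. *)
have Er u : pkey d (r^-1%g u) = pkey d u.
  apply: (block_monotone_eq (@lrow_lcol_inj _ _ t0) hr (sstd_row sd)) => v v' hvv' hv.
  by rewrite -!kE !(eqP (Es _)); apply: (sstd_row sd').
have Ed : d = d'.
  by apply: transversal_perm_colour => // u; apply: perm_key_inj; rewrite -Er -kE (eqP (Es _)).
by split=> // u; rewrite Ed -(eqP (Es (s u))) permK.
Qed.

Lemma coef_a_triangular d d' : d \in Gs -> d' \in Gs -> coef_a ab t0 d' d != 0 ->
  d = d' \/ (mu d < mu d')%N.
Proof.
move=> hd hd'; rewrite coef_aE; last exact: (subsetP (Gamma_sstd_sub _ _ _)) hd.
case: (pickP [pred s in C0 | eps d (s ∘ d') != 0]) => [s /andP[/= sC es] _|none].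
  have [le eq] := eps_moment hd hd' sC es.
  by move: le; rewrite leq_eqVlt => /orP[/eqP/eq[]|]; [left | right].
rewrite big1 ?eqxx // => s sC; have := none s; rewrite /= sC /= => /negbFE/eqP->.
by rewrite mulr0.
Qed.

(** The identity contributes 1. Any other nonzero term comes from some [s] preserving T_d; c-colours
    do not repeat in a column, so [s] moves only labels of d-colours and [eps] equals its sign,
    giving 1 again. *)
Lemma coef_a_diag d : d \in Gs -> 0 < coef_a ab t0 d d.
Proof.
move=> hd; have hR : d \in Rset ab t0 by apply: (subsetP (Gamma_sstd_sub _ _ _)) hd.
have [_ sd] := Gamma_sstdP hd.
have eps1 : eps d d = 1.
  have := @epsilonE n lam ab t0 d 1%g 1%g 1%g hR (group1 _) (group1 _) (group1 _).
  by rewrite shAB1 mulg1 mul1g /psgn odd_perm1.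
rewrite coef_aE // (bigD1 1%g) //= mulg1 eps1 mulr1 {1}/psgn odd_perm1.
rewrite ltr_pwDl // sumr_ge0 // => s /andP[sC _].
have [->|es] := eqVneq (eps d (s ∘ d)) 0; first by rewrite mulr0.
have [_ /(_ erefl) [_ Es]] := eps_moment hd hd sC es.
have Ep u : pcol d (s u) = pcol d u by apply: perm_key_inj.
have [xa [xb [ha hb E _ Exb]]] := perm_colour_stab Ep.
have := @epsilonE n lam ab t0 d 1%g xa xb hR (group1 _) ha hb.
rewrite mulg1 -E => ->; rewrite Exb ?psgn2 // => u cu.
apply/eqP/contraT => nsu; have := sstd_col_d sd nsu _ (Ep u).
by rewrite Ep cu; apply; move/col_stab_lcol: sC.
Qed.

Lemma coef_a_solve (f : 'S_n -> rat) : exists c : 'S_n -> rat,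
  forall d', d' \in Gs -> f d' = \sum_(d in Gs) c d * (coef_a ab t0 d' d)%:~R.
Proof.
pose k := #|Gs|; pose e (i : 'I_k) := enum_val i.
have eG i : e i \in Gs by apply: enum_valP.
pose A : 'M[rat]_k := \matrix_(i, j) (coef_a ab t0 (e i) (e j))%:~R.
have unitA : A \in unitmx.
  rewrite -row_free_unit; apply: inj_row_free => v vA; apply/rowP=> i0; rewrite mxE.
  apply/eqP; apply: contraT => v0.
  (* At an index of largest row moment in the support of a kernel vector, triangularity leaves only
     the diagonal term. *)
  case: (arg_maxnP (P := fun i => v 0 i != 0) (fun i => mu (e i)) v0) => i vi max.
  move/matrixP/(_ 0 i): vA; rewrite !mxE (bigD1 i) //= big1 ?addr0 => [/eqP|j ji].
    by rewrite mxE mulf_eq0 (negPf vi) intr_eq0 gt_eqF // coef_a_diag.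
  rewrite mxE; have [->|vj] := eqVneq (v 0 j) 0; first by rewrite mul0r.
  have [->|nz] := eqVneq (coef_a ab t0 (e j) (e i)) 0; first by rewrite mulr0.
  have [/enum_val_inj Eij|] := coef_a_triangular (eG i) (eG j) nz.
    by rewrite Eij eqxx in ji.
  by move=> lt; have := max j vj; rewrite /= leqNgt lt.
pose x := invmx A *m \col_i f (e i).
have Ax : A *m x = \col_i f (e i) by rewrite mulmxA mulmxV // mul1mx.
exists (fun d => \sum_(i | e i == d) x i 0) => d' hd'.
have [i0 ->] : exists i0, d' = e i0.
  by exists (enum_rank_in hd' d'); rewrite /e enum_rankK_in.
move/matrixP/(_ i0 0): Ax; rewrite !mxE => <-.
rewrite (big_enum_val (A := [in Gs])) /=; apply: eq_bigr => j _.
rewrite mxE mulrC (big_pred1 j) // => i /=.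
by rewrite (inj_eq enum_val_inj).
Qed.

End Triangular.

(** * Comparison of a homomorphism with the semistandard combination *)

Theorem corollary4p12 (n : nat) (n_gt0 : (0 < n)%N) (lam : intpart n) (ab : bicomp n)
    (t0 : tableau n lam) (Gamma : {set 'S_n})
    (HGamma : left_transversal (youngAB ab) Gamma)
    (phi : {additive specht lam -> ind_mod ab Gamma}) (hphi : is_hom phi) :
  exists c : 'S_n -> rat, forall x : specht lam,
    ind_rat (phi x) =
      \sum_(d in Gamma_sstd ab t0 Gamma) c d *: ind_rat (theta_hat ab t0 Gamma d x).
Proof.
pose Fh (f : {additive specht lam -> ind_mod ab Gamma}) x : rat := (coef_at (f (specht_e t0)) x)%:~R.
have [c hc] := coef_a_solve t0 HGamma (Fh phi); exists c.
pose th d := theta_hat ab t0 Gamma d.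
have hth d : d \in Gamma_sstd ab t0 Gamma -> is_theta_hat t0 d (th d).
  by move=> hd; apply: theta_hatP => //; apply: (subsetP (Gamma_sstd_sub _ _ _)) hd.
pose F x := Fh phi x - \sum_(d in Gamma_sstd ab t0 Gamma) c d * Fh (th d) x.
have hF : specht_fun ab t0 F.
  apply: specht_fun_lin => [|d /hth[hd _]]; exact: specht_fun_hom.
have thE d d' : d \in Gamma_sstd ab t0 Gamma -> d' \in Gamma ->
    Fh (th d) d' = (coef_a ab t0 d' d)%:~R.
  move=> hd hd'; congr (_%:~R); have [_ ->] := hth d hd.
  pose k y := coef_a ab t0 ((tab_quot t0 t0)^-1%g ∘ y) d.
  rewrite (coef_at_sum_vec HGamma k (Sub d' hd')) /k.
  rewrite (_ : tab_quot t0 t0 = 1%g) ?invg1 ?mulg1 //.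
  by apply/permP=> u; rewrite -(tab_invK t0 u) tab_quotE perm1.
(* A semistandard [d] has the same tableau as its representative in [Gamma], where the choice of [c]
   makes [F] vanish. *)
have F0 : forall x, F x = 0.
  apply: (sf_eq0 hF) => d sd.
  have [g [xa [xb [ha hb Ed]]]] := transversal_ex HGamma d.
  have gs : val g \in Gamma_sstd ab t0 Gamma.
    rewrite inE (valP g) (_ : T_ _ _ _ = T_ ab t0 d) /=; first exact/sstd_T.
    by apply/ffunP=> y; rewrite !T_perm_colour Ed perm_colour_shAB.
  rewrite Ed (sfM hF) // /F hc // (eq_bigr (fun d => c d * Fh (th d) (val g))) ?subrr ?mulr0 //.
  by move=> d' hd'; rewrite thE ?(valP g).
(* The image of any other polytabloid has the coefficients of the image of the one of [t0],
   translated by the inverse of rho_t, so the vanishing of [F] everywhere suffices. *)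
have coord (f : {additive specht lam -> ind_mod ab Gamma}) t (g : {d | d \in Gamma}) :
    is_hom f -> (f (specht_e t) g)%:~R = Fh f ((tab_quot t t0)^-1%g ∘ val g) :> rat.
  move=> hf; rewrite /Fh -(coef_at_act HGamma) -hf specht_act_e tab_moveK.
  by rewrite coef_at_basis.
move=> x; apply/ffunP=> g; have [k ->] := specht_span x.
rewrite !ffunE sum_ffunE raddf_sum sum_ffunE rmorph_sum /=.
under eq_bigr => t _ do rewrite raddfMz ffun_mulrzE rmorphM /= coord //.
under [RHS]eq_bigr => d hd.
  rewrite !ffunE raddf_sum sum_ffunE rmorph_sum scaler_sumr /=.
  under eq_bigr => t _ do
    rewrite (raddfMz (th d)) ffun_mulrzE rmorphM /= (coord _ _ _ (proj1 (hth d hd))).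
  over.
rewrite exchange_big /=; apply: eq_bigr => t _.
have /eqP := F0 ((tab_quot t t0)^-1%g ∘ val g); rewrite subr_eq0 => /eqP->.
by rewrite mulr_suml; apply: eq_bigr => d _; rewrite -mulrA.
Qed.
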